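(* Let $(M,F,\Phi)$ be a regular integrable system of type $(k,n)$ with compact orbits, with $M$ connected. Then the map $\rho$ is a bundle epimorphism from $\mathcal{L}$ to $\mathbb{Z}^l$ with $l\le n$; that is, after identifying $\operatorname{Im}\rho$ with $\mathbb{Z}^l$, where $l$ is the rank of $\operatorname{Im}\rho$, the restriction of $\rho$ to each fibre $\mathcal{L}_o$ is a surjective group homomorphism onto $\mathbb{Z}^l$. Moreover, for any path $\gamma$ in $\mathcal{O}_M$ with associated monodromy map $\mathcal{M}_\gamma$, one has $\rho\circ\mathcal{M}_\gamma=\rho$ on $\mathcal{L}_{\gamma(0)}$.
   Context: A regular (non-Hamiltonian) integrable system of type $(k,n)$ with compact orbits is a triple $(M,F,\Phi)$, where $M$ is a smooth manifold of dimension $k+n$, $F=(f_1,\dots,f_k):M\to\mathbb{R}^k$ is a smooth submersion, and $\Phi$ is a smooth locally free action of $\mathbb{R}^n$ on $M$ (all isotropy groups are discrete), all of whose orbits are compact, with $F\circ\Phi^{T}=F$ for all $T\in\mathbb{R}^n$. Thus every orbit is an $n$-torus. Orbit space: $\mathcal{O}_M$ is the set of orbits of $\Phi$ with the quotient topology and quotient map $q_\Phi:M\to\mathcal{O}_M$. Lattice bundle: for $o\in\mathcal{O}_M$, $\mathcal{L}_o\subset\mathbb{R}^n$ is the common isotropy group of $\Phi$ at the points of $o$ (a lattice of rank $n$). $\mathcal{L}=\bigsqcup_{o}\mathcal{L}_o\subset\mathcal{O}_M\times\mathbb{R}^n$ has the subspace topology, and $\pi_{\mathcal{L}}:\mathcal{L}\to\mathcal{O}_M$,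 $(o,T)\mapsto o$, is a covering map. The map $\rho$: for $T\in\mathcal{L}_o$ and $x\in q_\Phi^{-1}(o)$ let $\lambda_{T,x}(s)=\Phi^{sT}(x)$, $s\in[0,1]$, a closed path. With $\mathrm{Tor}_{H_1(M)}$ the torsion subgroup of the integral homology $H_1(M)$, define $\rho:\mathcal{L}\to H_1(M)/\mathrm{Tor}_{H_1(M)}$ by $\rho(T)=[\lambda_{T,x}]$ (independent of $x$). Monodromy map: for a path $\gamma:[0,1]\to\mathcal{O}_M$, $\mathcal{M}_\gamma:\mathcal{L}_{\gamma(0)}\to\mathcal{L}_{\gamma(1)}$ sends $v$ to the endpoint of the lift of $\gamma$ to the covering $\mathcal{L}$ starting at $v$; when $\gamma$ is a loop this is an automorphism of the lattice $\mathcal{L}_{\gamma(0)}$. *)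

(* Defs.v *)
(* MathComp, MathComp-Analysis, and the free abelian groups of multinomials. *)
From HB Require Import structures.
From mathcomp Require Import all_boot all_order all_algebra.
From mathcomp Require Import generic_quotient ring_quotient.
From mathcomp Require Import all_classical all_reals all_analysis.
From mathcomp Require Import freeg.

Set Implicit Arguments.
Unset Strict Implicit.
Unset Printing Implicit Defensive.

Import Order.TTheory GRing.Theory Num.Theory numFieldNormedType.Exports.

Local Open Scope classical_set_scope.
Local Open Scope ring_scope.
Local Open Scope quotient_scope.

(* Smooth maps between finite-dimensional normed spaces. The map [f] is total,
   but for an open [U] both predicates only depend on its values on [U]. In
   finite dimension, continuity of x |-> 'd f x amounts to continuity of
   x |-> 'd f x v = 'D_v f x for every v. *)
Section Smooth.
Context (R : realType) (V W : normedModType R).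

Fixpoint class_C (r : nat) (U : set V) (f : V -> W) : Prop :=
  match r with
  | 0 => forall x, U x -> {for x, continuous f}
  | r'.+1 => (forall x, U x -> differentiable f x) /\
             (forall v : V, class_C r' U (fun x => 'D_v f x))
  end.

Definition smooth_on (U : set V) (f : V -> W) : Prop :=
  forall r, class_C r U f.

End Smooth.

(* A chart is a homeomorphism [chart_map] from the open set [chart_dom] onto an
   open subset of R^d; outside of these sets [chart_map] and [chart_inv] take
   arbitrary values. *)
Record chart (R : realType) (M : topologicalType) (d : nat) := Chart {
  chart_dom : set M;
  chart_map : M -> 'rV[R]_d;
  chart_inv : 'rV[R]_d -> M;
  chart_open_dom : open chart_dom;
  chart_open_img : open (chart_map @` chart_dom);
  chart_mapK : forall x, chart_dom x -> chart_inv (chart_map x) = x;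
  chart_map_continuous : forall x, chart_dom x -> {for x, continuous chart_map};
  chart_inv_continuous :
    forall y, (chart_map @` chart_dom) y -> {for y, continuous chart_inv}
}.

Definition chart_img (R : realType) (M : topologicalType) d (c : chart R M d) :=
  chart_map c @` chart_dom c.

Record smooth_manifold (R : realType) (d : nat) := SmoothManifold {
  mfd_space :> topologicalType;
  mfd_hausdorff : hausdorff_space mfd_space;
  mfd_second_countable : @second_countable mfd_space;
  mfd_atlas : set (chart R mfd_space d);
  mfd_cover : forall x, exists2 c, mfd_atlas c & chart_dom c x;
  mfd_compatible : forall c c', mfd_atlas c -> mfd_atlas c' ->
    smooth_on (chart_map c @` (chart_dom c `&` chart_dom c'))
              (chart_map c' \o chart_inv c)
}.

(* The local expressions of [Phi : R^n x M -> M] and [F : M -> R^k] in charts. *)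
Section SmoothMaps.
Context (R : realType) (d : nat) (M : smooth_manifold R d).

Definition smooth_fun k (F : M -> 'rV[R]_k) : Prop :=
  forall c, mfd_atlas c -> smooth_on (chart_img c) (F \o chart_inv c).

Definition submersion k (F : M -> 'rV[R]_k) : Prop :=
  forall c, mfd_atlas c -> forall y, chart_img c y ->
    set_surj setT setT ('d (F \o chart_inv c) y : 'rV[R]_d -> 'rV[R]_k).

Definition smooth_family n (Phi : 'rV[R]_n -> M -> M) : Prop :=
  continuous (fun p : 'rV[R]_n * M => Phi p.1 p.2) /\
  forall c c', mfd_atlas c -> mfd_atlas c' ->
    smooth_on [set p : 'rV[R]_n * 'rV[R]_d |
                chart_img c p.2 /\ chart_dom c' (Phi p.1 (chart_inv c p.2))]
              (fun p => chart_map c' (Phi p.1 (chart_inv c p.2))).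

End SmoothMaps.

Record regular_integrable_system (R : realType) (k n : nat) :=
  RegularIntegrableSystem {
  ris_mfd :> smooth_manifold R (k + n);
  ris_F : ris_mfd -> 'rV[R]_k;
  ris_Phi : 'rV[R]_n -> ris_mfd -> ris_mfd;
  ris_F_smooth : smooth_fun ris_F;
  ris_F_submersion : submersion ris_F;
  ris_Phi_smooth : smooth_family ris_Phi;
  ris_Phi0 : forall x, ris_Phi 0 x = x;
  ris_PhiD : forall S T x, ris_Phi (S + T) x = ris_Phi S (ris_Phi T x);
  (* The isotropy groups are discrete: all their points are isolated. *)
  ris_locally_free : forall x,
    let G := [set T | ris_Phi T x = x] in isolated G = G;
  ris_compact_orbits : forall x, compact (range (ris_Phi ^~ x));
  ris_invariant : forall T, ris_F \o ris_Phi T = ris_F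
}.

(* Singular homology. *)
Section Simplex.
Context (R : realType).

Definition simplex (n : nat) : set 'rV[R]_n.+1 :=
  [set x | (forall i, 0 <= x 0 i) /\ \sum_i x 0 i = 1].
Arguments simplex : clear implicits.

Definition face_row n (i : 'I_n.+2) (x : 'rV[R]_n.+1) : 'rV[R]_n.+2 :=
  \row_j (if unlift i j is Some k then x 0 k else 0).

Lemma face_row_simplex n (i : 'I_n.+2) (x : simplex n) :
  face_row i (\val x) \in simplex n.+1.
Proof.
case: x => x /= /set_mem[x0 x1]; apply/mem_set; split => [j|].
  by rewrite mxE; case: unlift.
rewrite (bigD1_ord i) //= !mxE unlift_none add0r -[RHS]x1.
by apply: eq_bigr => j _; rewrite mxE liftK.
Qed.

Definition face n (i : 'I_n.+2) (x : simplex n) : simplex n.+1 :=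
  exist _ (face_row i (\val x)) (face_row_simplex i x).

Lemma face_row_continuous n (i : 'I_n.+2) : continuous (@face_row n i).
Proof.
move=> x A [P nP PA].
have nPj j : nbhs x (fun y : 'rV[R]_n.+1 => P 0 j (face_row i y 0 j)).
  have := nP 0 j; rewrite mxE.
  case E : (unlift i j) => [k|] nPj.
    have : nbhs x (fun y : 'rV[R]_n.+1 => P 0 j (y 0 k)).
      exact: (@coord_continuous R 1 n.+1 0 k x _ nPj).
    by apply: filterS => y; rewrite mxE E.
  apply: filterE => y; rewrite mxE E; exact: nbhs_singleton nPj.
have nP' : nbhs x (fun y : 'rV[R]_n.+1 => forall j, P 0 j (face_row i y 0 j)).
  exact: (@filter_forall _ _ _ (nbhs x) _ nPj).
apply: (@filterS _ (nbhs x) _ _ _ _ nP') => y yP; apply: PA => a j.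
by rewrite ord1; exact: yP.
Qed.

Lemma face_continuous n (i : 'I_n.+2) : continuous (@face n i).
Proof.
apply: continuous_comp_initial => x.
apply: (@continuous_comp _ _ _ (fun y : simplex n => \val y)).
  exact: initial_continuous.
exact: face_row_continuous.
Qed.

HB.instance Definition _ n (i : 'I_n.+2) :=
  @isContinuous.Build _ _ (@face n i) (@face_continuous n i).

End Simplex.

Arguments simplex : clear implicits.

Section Homology.
Context (R : realType) (M : topologicalType).

Definition singular_simplex (n : nat) := continuousType (simplex R n) M.

HB.instance Definition _ n := Choice.on (singular_simplex n).

Definition chain (n : nat) := {freeg (singular_simplex n) / int}.

HB.instance Definition _ n := GRing.Lmodule.on (chain n).

Definition face_simplex n (i : 'I_n.+2) (s : singular_simplex n.+1) :
  singular_simplex n := s \o face i.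

Definition boundary_simplex n (s : singular_simplex n.+1) : chain n :=
  \sum_(i < n.+2) (-1) ^+ i *: << face_simplex i s >>.

Definition boundary n : chain n.+1 -> chain n := fglift (@boundary_simplex n).

HB.instance Definition _ n :=
  GRing.isZmodMorphism.Build (chain n.+1) (chain n) (@boundary n)
    (lift_is_additive (@boundary_simplex n)).

Definition cycle1 : {pred chain 1} := fun c => boundary c == 0.

Fact cycle1_zmod_closed : zmod_closed cycle1.
Proof.
split=> [|c c']; rewrite /cycle1 !unfold_in ?raddf0// => /eqP c0 /eqP c'0.
by rewrite raddfB /= c0 c'0 subrr.
Qed.
HB.instance Definition _ :=
  GRing.isZmodClosed.Build (chain 1) cycle1 cycle1_zmod_closed.

Definition Z1 := {c : chain 1 | c \in cycle1}.
HB.instance Definition _ := SubChoice.on Z1.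
HB.instance Definition _ := [SubChoice_isSubZmodule of Z1 by <:].

Definition boundary1 : {pred Z1} :=
  fun c => `[< exists b : chain 2, boundary b = \val c >].

Fact boundary1_zmod_closed : zmod_closed boundary1.
Proof.
split=> [|c c']; rewrite /boundary1 !unfold_in.
  by apply/asboolP; exists 0; rewrite !raddf0.
move=> /asboolP[b bc] /asboolP[b' bc']; apply/asboolP.
by exists (b - b'); rewrite !raddfB /= bc bc'.
Qed.
HB.instance Definition _ :=
  GRing.isZmodClosed.Build Z1 boundary1 boundary1_zmod_closed.

Definition H1 := Quotient.quot boundary1.
HB.instance Definition _ := GRing.Zmodule.on H1.

Definition torsion1 : {pred H1} :=
  fun h => `[< exists2 m : nat, (0 < m)%N & h *+ m = 0 >].

Fact torsion1_zmod_closed : zmod_closed torsion1.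
Proof.
split=> [|h h']; rewrite /torsion1 !unfold_in.
  by apply/asboolP; exists 1%N.
move=> /asboolP[m m0 hm] /asboolP[m' m'0 hm']; apply/asboolP.
exists (m * m')%N; first by rewrite muln_gt0 m0.
by rewrite mulrnBl mulrnA hm mulnC mulrnA hm' !mul0rn subrr.
Qed.
HB.instance Definition _ :=
  GRing.isZmodClosed.Build H1 torsion1 torsion1_zmod_closed.

Definition H1_mod_torsion := Quotient.quot torsion1.
HB.instance Definition _ := GRing.Zmodule.on H1_mod_torsion.

(* The restriction of p to [0,1] as the singular simplex (1 - s, s) |-> p s. *)
Definition path_simplex (p : R -> M) (x : simplex R 1) : M :=
  p (\val x 0 ord_max).

Lemma path_simplex_continuous (p : R -> M) : continuous p -> continuous (path_simplex p).
Proof.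
move=> cp x.
have vc : continuous (fun y : simplex R 1 => \val y : 'rV[R]_2).
  exact: initial_continuous.
have lc : continuous (fun y : simplex R 1 => (\val y : 'rV[R]_2) 0 ord_max).
  move=> y; apply: (@continuous_comp _ _ _ _ (fun r : 'rV[R]_2 => r 0 ord_max)).
    exact: vc.
  exact: coord_continuous.
by apply: (@continuous_comp _ _ _ _ p x); [exact: lc|exact: cp].
Qed.

Definition path_chain (p : R -> M) (cp : continuous p) : chain 1 :=
  << (mkcts (path_simplex_continuous cp) : singular_simplex 1) >>.

Lemma path_chain_cycle (p : R -> M) (cp : continuous p) :
  p 0 = p 1 -> path_chain cp \in cycle1.
Proof.
move=> p01; rewrite unfold_in /cycle1 /boundary /path_chain liftU scale1r.
rewrite /boundary_simplex !big_ord_recl big_ord0 /= expr0 expr1 scale1r addr0.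
rewrite scaleN1r subr_eq0; apply/eqP; congr << _ >>.
apply/continuousEP => x; rewrite /face_simplex /= /mkcts /path_simplex /= !mxE.
have x1 : (\val x : 'rV[R]_1) 0 0 = 1.
  by case: x => x /= /set_mem[_]; rewrite big_ord1.
have -> : ord_max = fintype.lift ord0 ord0 :> 'I_2 by exact: val_inj.
rewrite liftK.
have <- : ord_max = fintype.lift ord0 ord0 :> 'I_2 by exact: val_inj.
by rewrite unlift_none x1 p01.
Qed.

Definition loop_class (p : R -> M) (cp : continuous p) (p01 : p 0 = p 1) :
  H1_mod_torsion :=
  \pi_H1_mod_torsion (\pi_H1 (exist _ (path_chain cp) (path_chain_cycle cp p01))).

End Homology.

Section OrbitSpace.
Context (R : realType) (k n : nat) (S : regular_integrable_system R k n).
Local Notation Phi := (@ris_Phi R k n S).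

Definition orbit_rel : rel S := fun x y => `[< exists T, Phi T x = y >].

Fact orbit_rel_equiv : equiv_class_of orbit_rel.
Proof.
split=> [x|x y|y x z].
- by apply/asboolP; exists 0; rewrite ris_Phi0.
- apply/idP/idP => /asboolP[T <-]; apply/asboolP; exists (- T);
  by rewrite -ris_PhiD addNr ris_Phi0.
- move=> /asboolP[T <-] /asboolP[U <-]; apply/asboolP; exists (U + T).
  by rewrite ris_PhiD.
Qed.

Canonical orbit_equiv := EquivRelPack orbit_rel_equiv.
Canonical orbit_encModRel := defaultEncModRel orbit_rel.

Definition orbit_space := quotient_topology {eq_quot orbit_rel}.
HB.instance Definition _ := Topological.on orbit_space.
HB.instance Definition _ := Quotient.on orbit_space.

Definition orbit_proj : S -> orbit_space := \pi_orbit_space.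

Definition lattice (o : orbit_space) : {pred 'rV[R]_n} :=
  fun T => `[< forall x, orbit_proj x = o -> Phi T x = x >].

Fact lattice_zmod_closed o : zmod_closed (lattice o).
Proof.
split=> [|T U]; rewrite !unfold_in.
  by apply/asboolP => x _; rewrite ris_Phi0.
move=> /asboolP TP /asboolP UP; apply/asboolP => x xo.
by rewrite ris_PhiD -{1}(UP x xo) -[Phi (- U) _]ris_PhiD addNr ris_Phi0 TP.
Qed.
HB.instance Definition _ o :=
  GRing.isZmodClosed.Build 'rV[R]_n (lattice o) (lattice_zmod_closed o).

Definition lattice_group (o : orbit_space) := {T : 'rV[R]_n | T \in lattice o}.
HB.instance Definition _ o := SubChoice.on (lattice_group o).
HB.instance Definition _ o := [SubChoice_isSubZmodule of lattice_group o by <:].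

Definition lattice_bundle : set (orbit_space * 'rV[R]_n) :=
  [set p | p.2 \in lattice p.1].

Definition bundle_proj (v : lattice_bundle) : orbit_space := (\val v).1.

Definition bundle_vec (v : lattice_bundle) : 'rV[R]_n := (\val v).2.

Definition fibre_incl (o : orbit_space) (T : lattice_group o) : lattice_bundle :=
  exist _ (o, \val T) (mem_set (valP T : lattice_bundle (o, \val T))).

Definition orbit_loop (T : 'rV[R]_n) (x : S) : R -> S := fun s => Phi (s *: T) x.

Lemma orbit_loop_continuous T x : continuous (orbit_loop T x).
Proof.
move=> s; have [cPhi _] := ris_Phi_smooth S.
have cs : {for s, continuous (fun s : R => (s *: T, x) : 'rV[R]_n * S)}.
  by apply: (@cvg_pair _ _ _ (nbhs s) (nbhs (s *: T)) (nbhs x) _ _ _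
    (fun s : R => s *: T) (fun=> x)); [exact: scalel_continuous|exact: cvg_cst].
by apply: (@continuous_comp _ _ _ _ (fun p : 'rV[R]_n * S => Phi p.1 p.2) s cs);
  exact: cPhi.
Qed.

Lemma orbit_loop_closed (v : lattice_bundle) (x : S) :
  orbit_proj x = bundle_proj v ->
  orbit_loop (bundle_vec v) x 0 = orbit_loop (bundle_vec v) x 1.
Proof.
case: v => -[b T] /= vP; move=> xo; have /set_mem/asboolP TP := vP.
by rewrite /orbit_loop scale0r scale1r ris_Phi0 TP.
Qed.

Definition loop_class_at (v : lattice_bundle) (x : S)
    (xv : orbit_proj x = bundle_proj v) : H1_mod_torsion R S :=
  loop_class (@orbit_loop_continuous (bundle_vec v) x) (orbit_loop_closed xv).

(* The class of the loop does not depend on the point x of the orbit (move x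
   along the orbit); [repr] selects one such point. *)
Definition rho (v : lattice_bundle) : H1_mod_torsion R S :=
  @loop_class_at v (repr (bundle_proj v)) (reprK (bundle_proj v)).

Definition is_path (gamma : R -> orbit_space) : Prop :=
  {within `[0, 1], continuous gamma}.

Definition is_lift (gamma : R -> orbit_space) (Gamma : R -> lattice_bundle) :=
  {within `[0, 1], continuous Gamma} /\
  (forall s, s \in `[0, 1] -> bundle_proj (Gamma s) = gamma s).

(* As the bundle projection is a covering map, the endpoint exists and is unique
   when [gamma] is a path and [v] lies over [gamma 0]; otherwise the value is the
   zero vector of the fibre over [gamma 1]. *)
Definition monodromy (gamma : R -> orbit_space) (v : lattice_bundle) :
    lattice_bundle :=
  xget (fibre_incl (0 : lattice_group (gamma 1)))
       [set w | exists Gamma, [/\ is_lift gamma Gamma, Gamma 0 = v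
                                & Gamma 1 = w]].

End OrbitSpace.

Arguments lattice_bundle {R k n} S.
Arguments rho {R k n} S v.

(* Main.v *)
(* Along an orbit, F is constant, and since the action is locally free the fibres of
   the submersion F coincide locally with the orbits. Hence, if Phi^T x = x and y is
   close to x, the point Phi^T y lies on the same local orbit as y, and T can be
   corrected by a small vector into a period of y. Together with uniform discreteness
   (a consequence of local freeness) and cocompactness of the period lattices (a
   consequence of compactness of the orbits), this shows that every lattice vector
   extends to a continuous section of the lattice bundle over a neighbourhood depending
   on the base point only. Along such a section the loops s |-> Phi^(s T) x form a free
   homotopy, so that their homology class is constant. As M is connected, all the
   fibres have the same image under rho; this image is a finitely generated
   torsion-free group, hence free, and its rank is at most n because a discrete subgroup
   of R^n has at most n independent elements. *)
Require Import Defs.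
From HB Require Import structures.
From mathcomp Require Import all_boot all_order all_algebra.
From mathcomp Require Import generic_quotient ring_quotient.
From mathcomp Require Import all_classical all_reals all_analysis.
From mathcomp Require Import finmap freeg ring lra.

Set Implicit Arguments.
Unset Strict Implicit.
Unset Printing Implicit Defensive.

Import Order.TTheory GRing.Theory Num.Theory numFieldNormedType.Exports.

Local Open Scope classical_set_scope.
Local Open Scope ring_scope.

(** * Strict differentiability of C^1 maps *)

Section StrictDifferentiability.
Context (R : realType).

(** Lets one mean value estimate serve both the flow, whose domain is a product with the maximum
    norm, and [F], whose domain is a row space. *)
Definition finite_frame (V : normedModType R) := exists N (e : 'I_N -> V) (c : V -> 'I_N -> R),
  (forall v, v = \sum_i c v i *: e i) /\ (forall v i, `|c v i| <= `|v|).

Lemma coord_le_norm m (v : 'rV[R]_m) j : `|v 0 j| <= `|v|.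
Proof.
rewrite [leRHS]/Num.Def.normr /= mx_normrE; apply/bigmax_geP; right => /=.
by exists (0, j).
Qed.

Lemma rV_norm_le m (v : 'rV[R]_m) (b : R) : 0 <= b -> (forall j, `|v 0 j| <= b) -> `|v| <= b.
Proof.
move=> b0 vb; rewrite [leLHS]/Num.Def.normr /= mx_normrE; apply/bigmax_leP; split => // -[i j] _ /=.
by rewrite ord1.
Qed.

Lemma rV_finite_frame m : finite_frame 'rV[R]_m.
Proof.
exists m, (fun i => delta_mx 0 i), (fun (v : 'rV[R]_m) i => v 0 i).
split=> v; last exact: coord_le_norm.
exact: row_sum_delta.
Qed.

Lemma rV_prod_finite_frame m p : finite_frame ('rV[R]_m * 'rV[R]_p)%type.
Proof.
exists (m + p)%N, (fun i => match fintype.split i with inl j => (delta_mx 0 j, 0)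
    | inr j => (0, delta_mx 0 j) end),
  (fun (v : 'rV[R]_m * 'rV[R]_p) i => match fintype.split i with inl j => v.1 0 j
    | inr j => v.2 0 j end); split => v; last first.
  move=> i; rewrite [leRHS]prod_normE le_max.
  by case: (fintype.split i) => j; rewrite coord_le_norm ?orbT.
rewrite big_split_ord /=.
under eq_bigr => i _ do rewrite (unsplitK (inl i)).
under [X in _ + X]eq_bigr => i _ do rewrite (unsplitK (inr i)).
case: v => a b /=; rewrite {1}[a]row_sum_delta {1}[b]row_sum_delta.
set A := \sum_i _; set B := \sum_i _.
have -> : \sum_(i < m) a 0 i *: ((delta_mx 0 i, 0) : 'rV[R]_m * 'rV[R]_p) = (A, 0).
  rewrite /A; elim/big_ind2: _ => //= [x [? ?] y [? ?] -> [-> ->]|i _].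
    by congr pair; rewrite addr0.
  by congr pair; rewrite scaler0.
have -> : \sum_(i < p) b 0 i *: ((0, delta_mx 0 i) : 'rV[R]_m * 'rV[R]_p) = (0, B).
  rewrite /B; elim/big_ind2: _ => //= [x [? ?] y [? ?] -> [-> ->]|i _].
    by congr pair; rewrite addr0.
  by congr pair; rewrite scaler0.
by congr pair; rewrite ?addr0 ?add0r.
Qed.

Lemma is_derive_line (V W : normedModType R) (f : V -> W) (q v : V) (t : R) :
  derivable f (q + t *: v) v ->
  is_derive t 1 (fun t : R => f (q + t *: v)) ('D_v f (q + t *: v)).
Proof.
move=> df; have E : (fun h : R => h^-1 *: (f (q + (h *: (1 : R) + t) *: v) - f (q + t *: v)))
    = (fun h : R => h^-1 *: (f (h *: v + (q + t *: v)) - f (q + t *: v))).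
  apply/funext => h; congr (_ *: (f _ - _)).
  by rewrite addrCA -scalerDl /GRing.scale /= mulr1.
split.
  by move: df; rewrite /derivable -E.
by rewrite /derive -E.
Qed.

(** The mean value theorem is applied to each coordinate along the segment from [y] to [x]; the
    derivative at the intermediate point is compared with that at [x0] through the continuous
    partial derivatives along the frame. *)
Lemma C1_strictly_differentiable (V : normedModType R) m (f : V -> 'rV[R]_m) (U : set V) (x0 : V) :
  finite_frame V -> class_C 1 U f -> nbhs x0 U ->
  forall eps : R, 0 < eps -> exists2 d : R, 0 < d & forall x y, ball x0 d x -> ball x0 d y ->
   `|f x - f y - 'D_(x - y) f x0| <= eps * `|x - y|.
Proof.
move=> [N [e [c [ce cle]]]] [dU cU] U0 eps eps0.
have Ux0 := nbhs_singleton U0.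
(* Each of the [N] frame directions contributes at most [eps'] times the norm; [N.+1] keeps the
   denominator positive. *)
pose eps' := eps / N.+1%:R.
have eps'0 : 0 < eps' by rewrite divr_gt0.
have near_i i : \forall x \near x0, `|'D_(e i) f x - 'D_(e i) f x0| < eps'.
  exact: (cvgrPdistC_lt _ _).1 (cU (e i) x0 Ux0) _ eps'0.
have : nbhs x0 (U `&` [set x | forall i, `|'D_(e i) f x - 'D_(e i) f x0| < eps']).
  apply: filterI U0 _; exact: (@filter_forall _ _ _ (nbhs x0) _ near_i).
move=> /nbhs_ballP[d /= d0 dP]; exists d => // x y xd yd.
set v := x - y.
have seg (t : R) : 0 <= t <= 1 -> ball x0 d (y + t *: v).
  move=> /andP[t0 t1]; move: xd yd; rewrite -!ball_normE /= => xd yd.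
  have -> : x0 - (y + t *: v) = (1 - t) *: (x0 - y) + t *: (x0 - x).
    rewrite [in RHS]scalerBl scale1r -addrA [- _ + _]addrC -scalerBr opprB.
    by rewrite [x0 - x + _]addrC addrA subrK opprD addrA -scalerN opprB.
  rewrite (le_lt_trans (ler_normD _ _))// !normrZ (ger0_norm t0) ger0_norm ?subr_ge0//.
  (* For [t = 0] strictness comes from [y], otherwise from the term with [x]. *)
  have [->|tn0] := eqVneq t 0; first by rewrite subr0 mul1r mul0r addr0.
  have t00 : 0 < t by rewrite lt_def tn0.
  rewrite (@lt_le_trans _ _ ((1 - t) * d + t * d))//; last by rewrite -mulrDl subrK mul1r.
  by rewrite ler_ltD// ?ltr_pM2l// ler_wpM2l ?subr_ge0// ltW.
apply: rV_norm_le => [|j]; first by rewrite mulr_ge0// ltW.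
pose g t := f (y + t *: v) 0 j.
have dg (t : R) : 0 <= t <= 1 -> is_derive t 1 g (('D_v f (y + t *: v)) 0 j).
  move=> /seg /dP[/dU df _].
  have [D1 D2] := is_derive_line (@diff_derivable _ _ _ f _ v df).
  split; first by move/derivable_mxP : D1; apply.
  by rewrite -D2 derive_mx// mxE.
have [t tI gt] : exists2 t, t \in `]0, 1[%R & g 1 - g 0 = ('D_v f (y + t *: v)) 0 j * (1 - 0).
  apply: MVT => //.
    move=> t; rewrite in_itv /= => /andP[t0 t1]; apply: dg.
    by rewrite !ltW.
  apply: derivable_within_continuous => t; rewrite in_itv /= => t01.
  by have [] := dg t t01.
move: tI; rewrite in_itv /= => /andP[t0 t1].
have bt : ball x0 d (y + t *: v) by apply: seg; rewrite !ltW.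
rewrite !mxE; have -> : f x 0 j - f y 0 j = ('D_v f (y + t *: v)) 0 j.
  move: gt; rewrite subr0 mulr1 /g scale1r scale0r addr0 => <-.
  by rewrite /v addrCA subrr addr0.
have [Ut near_t] := dP _ bt.
have Dv z : U z -> 'D_v f z = \sum_i c v i *: 'D_(e i) f z.
  move=> /dU df; rewrite deriveE// {1}[v]ce linear_sum.
  by apply: eq_bigr => i _; rewrite linearZ -deriveE.
rewrite !Dv// !summxE -sumrB.
rewrite (le_trans (ler_norm_sum _ _ _))//.
rewrite (@le_trans _ _ (\sum_(i < N) eps' * `|v|))//; last first.
  rewrite sumr_const card_ord -mulr_natl mulrA ler_wpM2r// /eps'.
  rewrite mulrCA ger_pMr// ler_pdivrMr// mul1r ler_nat//.
apply: ler_sum => i _; rewrite !mxE -mulrBr normrM mulrC.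
apply: ler_pM => //; apply: ltW; apply: le_lt_trans (near_t i).
by apply: le_trans (coord_le_norm _ j); rewrite !mxE.
Qed.

End StrictDifferentiability.

(** Joins completeness to the normed structure of matrices, so that the Banach fixed point theorem
    applies to row vectors. *)
HB.instance Definition _ (R : realType) m n := Complete.on 'M[R]_(m, n).

(** * Local transitivity on the fibres of a submersion *)

Section LocalTransitivity.
Context (R : realType).

Lemma mulmx_bounded m p (M : 'M[R]_(m, p)) :
  exists2 C : R, 0 < C & forall u : 'rV_m, `|u *m M| <= C * `|u|.
Proof.
exists (1 + \sum_i \sum_j `|M i j|) => [|u].
  by rewrite ltr_wpDr// sumr_ge0// => i _; rewrite sumr_ge0.
apply: rV_norm_le => [|j].
  by rewrite mulr_ge0// addr_ge0// sumr_ge0// => i _; rewrite sumr_ge0.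
rewrite mxE (le_trans (ler_norm_sum _ _ _))// mulrDl mul1r ler_wpDl//.
rewrite mulr_suml; apply: ler_sum => i _.
rewrite normrM mulrC ler_pM ?coord_le_norm//.
by rewrite (bigD1 j)//= lerDl sumr_ge0.
Qed.

(** The row space of [A] lies in the kernel of [B], and both have rank [n]. *)
Lemma sub_row_of_ker k n (A : 'M[R]_(n, k + n)) (B : 'M[R]_(k + n, k)) (v : 'rV[R]_(k + n)) :
  row_free A -> row_full B -> A *m B = 0 -> v *m B = 0 -> exists w : 'rV_n, v = w *m A.
Proof.
move=> /eqP rA /eqP rB /sub_kermxP AB /sub_kermxP vB.
have /eqmxP AK : (A == kermx B)%MS.
  by rewrite -(mxrank_leqif_eq AB).2 mxrank_ker rA rB addKn.
by apply/submxP; rewrite AK.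
Qed.

(* With A P = 1, the equation (f (t, y) - z) P = 0 is solved for t by contraction; as
   (B, P) is injective, a solution with g (f (t, y)) = g z satisfies f (t, y) = z. *)
Lemma local_transitivity k n (f : 'rV[R]_n * 'rV[R]_(k + n) -> 'rV[R]_(k + n))
    (g : 'rV[R]_(k + n) -> 'rV[R]_k) (y0 : 'rV[R]_(k + n))
    (A : 'M[R]_(n, k + n)) (B : 'M[R]_(k + n, k)) :
  (forall eps : R, 0 < eps -> exists2 d : R, 0 < d & forall s t y, `|s| < d -> `|t| < d ->
     `|y - y0| < d -> `|f (s, y) - f (t, y) - (s - t) *m A| <= eps * `|s - t|) ->
  (forall eps : R, 0 < eps -> exists2 d : R, 0 < d & forall y z, `|y - y0| < d ->
     `|z - y0| < d -> `|g y - g z - (y - z) *m B| <= eps * `|y - z|) ->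
  (exists2 d : R, 0 < d & forall y, `|y - y0| < d -> f (0, y) = y) ->
  (exists2 d : R, 0 < d & forall t y, `|t| < d -> `|y - y0| < d -> g (f (t, y)) = g y) ->
  row_free A -> row_full B -> A *m B = 0 ->
  forall eps : R, 0 < eps -> exists2 d : R, 0 < d & forall y z, `|y - y0| < d ->
    `|z - y0| < d -> g y = g z -> exists2 t, `|t| < eps & f (t, y) = z.
Proof.
move=> fA gB [d1 d10 f0] [d2 d20 gf] rfA rfB AB eps eps0.
pose P := pinvmx A; have AP : A *m P = 1%:M by rewrite mulmxVp.
pose Q := row_mx B P.
have rfQ : row_free Q.
  apply: inj_row_free => v; rewrite mul_mx_row -row_mx0 => /eq_row_mx[vB vP].
  have [w vw] := sub_row_of_ker rfA rfB AB vB.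
  by move: vP; rewrite vw -mulmxA AP mulmx1 => ->; rewrite mul0mx row_mx0.
(* On the kernel of [P], the top block of the inverse of [Q] recovers a vector from its image under
   [B]. *)
pose E := usubmx (pinvmx Q).
have vE (v : 'rV_(k + n)) : v *m P = 0 -> v = (v *m B) *m E.
  move=> vP; rewrite -{1}[v](mulmxKp rfQ) mul_mx_row vP -[pinvmx Q]vsubmxK.
  by rewrite mul_row_col mul0mx addr0.
have [CA CA0 CAP] := mulmx_bounded A.
have [CP CP0 CPP] := mulmx_bounded P.
have [CE CE0 CEP] := mulmx_bounded E.
have e1 : 0 < (2 * CP)^-1 by rewrite invr_gt0 mulr_gt0.
have [d3 d30 fAd] := fA _ e1.
have e2 : 0 < (2 * CE)^-1 by rewrite invr_gt0 mulr_gt0.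
have [d4 d40 gBd] := gB _ e2.
have [d5 d50 fA1] := fA 1 ltr01.
(* On the ball of radius [r] the iteration contracts by 1/2 ([d3]), [g] is invariant ([d2]) and
   [f (t, y)] stays within [d4] of [y0]. The final halving makes the bounds strict. *)
pose r : R := Num.min (Num.min (Num.min eps d2) (Num.min d3 d5)) (d4 / (2 * (CA + 1))) / 2.
have CA1 : 0 < CA + 1 by rewrite addr_gt0.
have r0 : 0 < r by rewrite divr_gt0// !lt_min eps0 d20 d30 d50 divr_gt0// mulr_gt0.
have r2 : r < r + r by rewrite ltrDl.
have rr : r + r = Num.min (Num.min (Num.min eps d2) (Num.min d3 d5)) (d4 / (2 * (CA + 1))).
  by rewrite -splitr.
have [reps rd2 rd3 rd5 rd4] : [/\ r < eps, r < d2, r < d3, r < d5 & r < d4 / (2 * (CA + 1))].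
  by move: r2; rewrite rr !lt_min => /andP[/andP[/andP[-> ->] /andP[-> ->]] ->].
clear r2 rr; clearbody r.
(* [r / (4 * CP)] makes [N 0] at most [r / 2], so that the ball of radius [r] is mapped to itself;
   [d4 / 2] leaves the other half of [d4] to the displacement. *)
pose d : R := Num.min (Num.min (Num.min d1 d2) (Num.min d3 d5)) (Num.min (d4 / 2) (r / (4 * CP))).
exists d => [|y z].
  by rewrite !lt_min d10 d20 d30 d50 !divr_gt0// ?mulr_gt0.
rewrite !lt_min => /andP[/andP[/andP[yd1 yd2] /andP[yd3 yd5]] /andP[yd4 ydr]].
move=> /andP[/andP[/andP[zd1 zd2] /andP[zd3 zd5]] /andP[zd4 zdr]] gyz.
(* Newton's iteration with the derivative frozen at the base point. *)
pose N t := t - (f (t, y) - z) *m P.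
have NB s t : `|s| <= r -> `|t| <= r -> `|N s - N t| <= 2^-1 * `|s - t|.
  move=> sr tr; have -> : N s - N t = - ((f (s, y) - f (t, y) - (s - t) *m A) *m P).
    rewrite /N !mulmxBl -!mulmxA AP !mulmx1.
    have aux (a b c : 'rV[R]_n) : s - (a - c) - (t - (b - c)) = - (a - b - (s - t)).
      have -> : a - b = (a - c) - (b - c) by rewrite opprB addrA subrK.
      move: (a - c) (b - c) => p q.
      by rewrite !opprB addrACA [RHS]addrACA [- p - t]addrC.
    exact: aux.
  rewrite normrN (le_trans (CPP _))// (le_trans (ler_wpM2l (ltW CP0) (fAd _ _ _ _ _ _)))//.
  - exact: le_lt_trans rd3.
  - exact: le_lt_trans rd3.
  - by rewrite mulrA invfM mulrCA mulfV ?gt_eqF// mulr1.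
have Nball : set_fun [set t : 'rV[R]_n | `|t| <= r] [set t | `|t| <= r] N.
  move=> t /= tr; have t0 : `|0 : 'rV[R]_n| <= r by rewrite normr0 ltW.
  rewrite -[N t](subrK (N 0)) (le_trans (ler_normD _ _))// [leRHS]splitr lerD//.
    by rewrite (le_trans (NB _ _ tr t0))// subr0 mulrC ler_wpM2r// invr_ge0.
  rewrite /N sub0r normrN (le_trans (CPP _))// f0//.
  rewrite (@le_trans _ _ (CP * (r / (4 * CP) + r / (4 * CP))))//; last first.
    suff -> : CP * (r / (4 * CP) + r / (4 * CP)) = r / 2 by [].
    by field; rewrite gt_eqF.
  rewrite ler_wpM2l ?(ltW CP0)//.
  have -> : y - z = (y - y0) + (y0 - z) by rewrite addrA subrK.
  by rewrite (le_trans (ler_normD _ _))// lerD// ltW// distrC.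
have [t tr tN] : exists2 t, `|t| <= r & t = N t.
  pose N' : {fun [set t : 'rV[R]_n | `|t| <= r] >-> [set t | `|t| <= r]} :=
    HB.pack N (isFun.Build _ _ _ _ N Nball).
  suff [t tr tN] : exists2 t, [set t : 'rV[R]_n | `|t| <= r] t & t = N' t by exists t.
  apply: banach_fixed_point.
  - exists 2^-1%:nng; split; first by rewrite /= invf_lt1// ltr1n.
    by move=> [s t] [/= sr tr]; exact: NB.
  - have := @closed_ball_closed R 'rV[R]_n 0 r.
    rewrite closed_ballE// /closed_ball_; congr closed.
    by apply/seteqP; split => x /=; rewrite sub0r normrN.
  - by exists 0; rewrite /= normr0 ltW.
exists t; first exact: le_lt_trans reps.
have fP : (f (t, y) - z) *m P = 0.
  by apply: oppr_inj; apply: (addrI t); rewrite oppr0 addr0 -[RHS]/t [RHS]tN.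
have gftz : g (f (t, y)) = g z by rewrite gf// (le_lt_trans tr).
have fty : `|f (t, y) - y| <= (CA + 1) * `|t|.
  have t5 : `|t| < d5 by exact: le_lt_trans rd5.
  have /= := fA1 t 0 y t5; rewrite normr0 subr0 f0// mul1r => /(_ d50 yd5) H.
  rewrite mulrDl mul1r -[f _ - y](subrK (t *m A)).
  by rewrite (le_trans (ler_normD _ _))// addrC lerD.
have fty0 : `|f (t, y) - y0| < d4.
  have -> : f (t, y) - y0 = (f (t, y) - y) + (y - y0) by rewrite addrA subrK.
  rewrite (le_lt_trans (ler_normD _ _))// (splitr d4) ler_ltD//.
  rewrite (le_trans fty)// (@le_trans _ _ ((CA + 1) * (d4 / (2 * (CA + 1)))))//.
    by rewrite ler_pM2l// (le_trans tr)// ltW.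
  by rewrite invfM mulrCA [_ * (_ / _)]mulrCA mulfV ?gt_eqF// mulr1.
have z4 : `|z - y0| < d4 by rewrite (lt_trans zd4)// ltr_pdivrMr// ltr_pMr// ltr1n.
have := gBd _ _ fty0 z4; rewrite gftz subrr sub0r normrN => H.
(* As [g] agrees at both points, the difference is small under [B]; [E] transfers this to the
   difference itself, which is then at most half its own norm. *)
have : `|f (t, y) - z| <= 2^-1 * `|f (t, y) - z|.
  rewrite {1}(vE _ fP) (le_trans (CEP _))// (le_trans (ler_wpM2l (ltW CE0) H))//.
  by rewrite mulrA invfM mulrCA mulfV ?gt_eqF// mulr1.
rewrite -subr_ge0 -{2}[ `|_| ]mul1r -mulrBl => H2.
apply/eqP; rewrite -subr_eq0 -normr_le0.
by rewrite -(@nmulr_rge0 _ (2^-1 - 1))// subr_lt0 invf_lt1// ltr1n.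
Qed.

End LocalTransitivity.

(** * Local structure of the orbits *)

Section LocalOrbits.
Context (R : realType) (k n : nat) (S : regular_integrable_system R k n).
Local Notation Phi := (@ris_Phi R k n S).
Local Notation F := (@ris_F R k n S).

Lemma Phi_continuous : continuous (fun p : 'rV[R]_n * S => Phi p.1 p.2).
Proof. by case: (ris_Phi_smooth S). Qed.

Lemma continuous_Phi (T : topologicalType) (u : T -> 'rV[R]_n) (w : T -> S) (t : T) :
  {for t, continuous u} -> {for t, continuous w} ->
  {for t, continuous (fun t => Phi (u t) (w t))}.
Proof.
move=> cu cw.
have cuw : {for t, continuous (fun t => (u t, w t) : 'rV[R]_n * S)}.
  by apply: (@cvg_pair _ _ _ (nbhs t) (nbhs (u t)) (nbhs (w t)) _ _ _ u w).
by apply: (@continuous_comp _ _ _ _ (fun p : 'rV[R]_n * S => Phi p.1 p.2) t cuw);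
  exact: Phi_continuous.
Qed.

Section Chart.
Variables (x : S) (c : chart R S (k + n)).
Hypotheses (cat : mfd_atlas c) (xc : chart_dom c x).

Let y0 := chart_map c x.
Let f (p : 'rV[R]_n * 'rV[R]_(k + n)) := chart_map c (Phi p.1 (chart_inv c p.2)).
Let g := F \o chart_inv c.
Let W := [set p : 'rV[R]_n * 'rV[R]_(k + n) |
  chart_img c p.2 /\ chart_dom c (Phi p.1 (chart_inv c p.2))].

Let img_y0 : chart_img c y0. Proof. by exists x. Qed.

Let inv_y0 : chart_inv c y0 = x. Proof. exact: chart_mapK. Qed.

Let W_y0 : W (0, y0). Proof. by split; rewrite /= ?inv_y0 ?ris_Phi0. Qed.

Let nbhs_img : nbhs y0 (chart_img c).
Proof. by apply: open_nbhs_nbhs; split => //; exact: chart_open_img. Qed.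

Let nbhs_W : nbhs ((0, y0) : 'rV[R]_n * 'rV[R]_(k + n)) W.
Proof.
apply: filterI.
  by apply: (@cvg_snd _ _ (nbhs (0 : 'rV[R]_n)) (nbhs y0)).
have : {for ((0, y0) : 'rV[R]_n * 'rV[R]_(k + n)), continuous
    (fun p : 'rV[R]_n * 'rV[R]_(k + n) => Phi p.1 (chart_inv c p.2))}.
  apply: continuous_Phi; first exact: cvg_fst.
  apply: (@continuous_comp _ _ _ (fun p : 'rV[R]_n * 'rV[R]_(k + n) => p.2)).
    exact: cvg_snd.
  exact: chart_inv_continuous.
apply; rewrite /= inv_y0 ris_Phi0.
by apply: open_nbhs_nbhs; split => //; exact: chart_open_dom.
Qed.

Let f_C1 : class_C 1 W f.
Proof. by have [_] := ris_Phi_smooth S; move=> /(_ c c cat cat 1%N). Qed.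

Let g_C1 : class_C 1 (chart_img c) g.
Proof. exact: (ris_F_smooth cat). Qed.

Let f0 y : chart_img c y -> f (0, y) = y.
Proof. by move=> [z zc <-]; rewrite /f /= ris_Phi0 chart_mapK. Qed.

Let gf t y : W (t, y) -> g (f (t, y)) = g y.
Proof.
move=> [/= yi ty]; rewrite /g /f /= chart_mapK//.
by have := ris_invariant S t => /(congr1 (fun h => h (chart_inv c y))).
Qed.

Let f_line (v : 'rV[R]_n) : \forall s \near (0 : R), W (s *: v, y0).
Proof.
have : {for (0 : R), continuous (fun s : R => (s *: v, y0) : 'rV[R]_n * 'rV[R]_(k + n))}.
  apply: (@cvg_pair _ _ _ (nbhs (0 : R)) (nbhs (0 *: v)) (nbhs y0) _ _ _
    (fun s : R => s *: v) (fun=> y0)); [exact: scalel_continuous|exact: cvg_cst].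
by apply; rewrite scale0r.
Qed.

Let is_derive_f_line (v : 'rV[R]_n) (s : R) : W (s *: v, y0) ->
  is_derive s 1 (fun s : R => f (s *: v, y0)) ('d f (s *: v, y0) (v, 0)).
Proof.
move=> Ws; have E (r : R) : (r *: v, y0) = ((0, y0) : 'rV[R]_n * 'rV[R]_(k + n)) + r *: (v, 0).
  by congr pair; rewrite /= ?add0r// scaler0 addr0.
have df := f_C1.1 _ Ws.
have -> : (fun s : R => f (s *: v, y0)) = (fun s : R => f ((0, y0) + s *: (v, 0))).
  by apply/funext => r; rewrite E.
rewrite -deriveE// E; apply: is_derive_line.
by apply: diff_derivable; rewrite -E.
Qed.

(* The derivative of the flow line at time s is the image of the derivative at
   time 0 under the differential of Phi^(s v), hence a flow line with zero initial
   velocity is constant. *)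
Let generator_neq0 (v : 'rV[R]_n) : 'd f (0, y0) (v, 0) = 0 -> v = 0.
Proof.
move=> dv0.
pose u (s : R) := f (s *: v, y0).
have u0 : u 0 = y0 by rewrite /u scale0r f0.
have du0 : is_derive (0 : R) 1 u 0.
  have := @is_derive_f_line v 0; rewrite scale0r dv0; exact.
have diffu0 : differentiable u 0 by apply/derivable1_diffP; case: du0.
have du s : W (s *: v, y0) -> is_derive s 1 u 0.
  move=> Ws; have Dus := is_derive_f_line Ws.
  have dfs := f_C1.1 _ Ws.
  suff E : 'd f (s *: v, y0) (v, 0) = 0 by rewrite -E.
  have D1 : is_derive (0 : R) 1 (fun r => u (r + s)) ('d f (s *: v, y0) (v, 0)).
    have E : (fun h : R => h^-1 *: (u (h *: (1 : R) + 0 + s) - u (0 + s)))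
       = (fun h : R => h^-1 *: (u (h *: (1 : R) + s) - u s)).
      by apply/funext => h; rewrite addr0 add0r.
    case: Dus => D1 D2; split; first by rewrite /derivable E.
    by rewrite /derive E.
  rewrite -(@derive_val _ _ _ _ _ _ _ D1).
  pose h (r : R) := f (s *: v, u r).
  (* The group law turns [u (r + s)], for [r] near 0, into the time-[s] flow applied to [u r]. *)
  have near_uh : {near 0, (fun r => u (r + s)) =1 h}.
    apply: filterS (f_line v) => r [_ /= Wr].
    by rewrite /h /u /f /= (chart_mapK Wr) -ris_PhiD -scalerDl addrC.
  rewrite (near_eq_derive _ near_uh)//.
  have dcst : differentiable ((fun=> s *: v) : R -> 'rV[R]_n) 0.
    exact: (differentiable_cst (s *: v) (0 : R)).
  have dh1 : differentiable (fun r : R => (s *: v, u r) : 'rV[R]_n * 'rV[R]_(k + n)) 0.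
    exact: differentiable_pair.
  have dfs' : differentiable f (s *: v, u 0) by rewrite u0.
  have -> : h = f \o (fun r : R => (s *: v, u r)) by [].
  rewrite deriveE; last exact: differentiable_comp.
  rewrite diff_comp//= diff_pair//=.
  rewrite diff_cst -(deriveE (1 : R) diffu0) (@derive_val _ _ _ _ _ _ _ du0).
  exact: linear0.
have [d /= d0 dW] := f_line v.
have ucst s : 0 < s < d -> u s = y0.
  move=> /andP[s0 sd]; apply/rowP => j.
  have W' t : 0 <= t <= s -> W (t *: v, y0).
    move=> /andP[t0 ts]; apply: dW; rewrite /= sub0r normrN ger0_norm//.
    exact: le_lt_trans sd.
  have du' t : 0 <= t <= s -> is_derive t 1 (fun t => u t 0 j) 0.
    move=> /W'/du[D1 D2]; split; first by move/derivable_mxP : D1; apply.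
    by move: D2; rewrite derive_mx// => /rowP/(_ j); rewrite !mxE.
  have [||t _] := @MVT R (fun t => u t 0 j) (fun=> 0) 0 s s0.
  - move=> t; rewrite in_itv /= => /andP[t0 ts]; apply: du'.
    by rewrite !ltW.
  - apply: derivable_within_continuous => t; rewrite in_itv /= => ts.
    by have [] := du' t ts.
  - by rewrite mul0r u0 => /eqP; rewrite subr_eq0 => /eqP.
(* Arbitrarily short positive multiples of [v] fix [x], while 0 is isolated in the isotropy group;
   hence one of these multiples vanishes. *)
have stab s : 0 < s < d -> Phi (s *: v) x = x.
  move=> sd; have [_ /= Ws] : W (s *: v, y0).
    by case/andP : sd => s0 sd; apply: dW; rewrite /= sub0r normrN gtr0_norm.
  rewrite inv_y0 in Ws; have := ucst s sd.
  rewrite /u /f /= inv_y0 => /(congr1 (chart_inv c)).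
  by rewrite chart_mapK// inv_y0.
have := ris_locally_free x => /= /seteqP[_ /(_ 0)]; case; first exact: ris_Phi0.
move=> _ [V V0 VG].
have : \forall s \near (0 : R), V (s *: v).
  by have := @scalel_continuous _ _ v (0 : R); apply; rewrite scale0r.
move=> [e /= e0 eV].
pose s := Num.min d e / 2.
have me0 : 0 < Num.min d e by rewrite lt_min d0.
have s0 : 0 < s by rewrite divr_gt0.
have : s < Num.min d e by rewrite ltr_pdivrMr// ltr_pMr// ltr1n.
rewrite lt_min => /andP[sd se].
have : (V `&` [set T | Phi T x = x]) (s *: v).
  split; last by apply: stab; rewrite s0.
  by apply: eV; rewrite /= sub0r normrN gtr0_norm.
rewrite VG /= => /eqP; rewrite scaler_eq0 gt_eqF//= => /eqP//.
Qed.

Let dT (v : 'rV[R]_n) : 'rV[R]_(k + n) := 'd f (0, y0) (v, 0).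

Let dT_linear : linear dT.
Proof.
move=> a v w; rewrite /dT -linearP; congr ('d f _ _).
by congr pair; rewrite /= scaler0 addr0.
Qed.

Let dTL : {linear 'rV[R]_n -> 'rV[R]_(k + n)} :=
  HB.pack dT (GRing.isLinear.Build _ _ _ _ dT dT_linear).
(** With row vectors, the row space of [A] is the tangent space of the orbit and the kernel of [B]
    that of the fibre of [F]. *)
Let A := lin1_mx dTL.
Let B : 'M[R]_(k + n, k) := lin1_mx ('d g y0).

Let AE (v : 'rV[R]_n) : v *m A = 'd f (0, y0) (v, 0).
Proof. by rewrite mul_rV_lin1. Qed.

Let BE (v : 'rV[R]_(k + n)) : v *m B = 'd g y0 v.
Proof. by rewrite mul_rV_lin1. Qed.

Let A_free : row_free A.
Proof. by apply: inj_row_free => v; rewrite AE => /generator_neq0. Qed.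

Let B_full : row_full B.
Proof.
rewrite -sub1mx; apply/row_subP => i; apply/submxP.
have [v _ vE] := ris_F_submersion cat img_y0 (I : setT (row i 1%:M)).
by exists v; rewrite BE.
Qed.

(** [F] is constant along flow lines; differentiate at time zero. *)
Let AB0 : A *m B = 0.
Proof.
apply/row_matrixP => i; rewrite row_mul row0 BE rowE AE.
set v := delta_mx 0 i.
have := is_derive_f_line (_ : W (0 *: v, y0)); rewrite scale0r => /(_ W_y0).
set u := fun s : R => _ => du.
have diffu : differentiable u 0 by apply/derivable1_diffP; case: du.
have u0 : u 0 = y0 by rewrite /u scale0r f0.
have dg : differentiable g (u 0) by rewrite u0; exact: g_C1.1.
have E : 'D_1 (g \o u) (0 : R) = 'd g y0 ('d f (0, y0) (v, 0)).
  rewrite deriveE; last exact: differentiable_comp.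
  by rewrite diff_comp//= -(deriveE (1 : R) diffu) (@derive_val _ _ _ _ _ _ _ du) u0.
rewrite -E.
have near_cst : {near (0 : R), g \o u =1 cst (g y0)}.
  by apply: filterS (f_line v) => s Ws; rewrite /= gf.
by rewrite (near_eq_derive _ near_cst)//= derive_cst.
Qed.

Let f_strict (eps : R) : 0 < eps -> exists2 d : R, 0 < d & forall s t y, `|s| < d -> `|t| < d ->
  `|y - y0| < d -> `|f (s, y) - f (t, y) - (s - t) *m A| <= eps * `|s - t|.
Proof.
move=> eps0.
have [d d0 dP] := C1_strictly_differentiable (rV_prod_finite_frame R n (k + n)) f_C1 nbhs_W eps0.
exists d => // s t y sd td yd.
have inball (r : 'rV[R]_n) : `|r| < d -> ball ((0, y0) : 'rV[R]_n * 'rV[R]_(k + n)) d (r, y).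
  by move=> rd; split => /=; rewrite -ball_normE /= ?sub0r ?normrN// distrC.
have := dP _ _ (inball _ sd) (inball _ td).
have -> : (s, y) - (t, y) = (s - t, 0) :> 'rV[R]_n * 'rV[R]_(k + n).
  by congr pair; exact: subrr.
rewrite deriveE; last exact: f_C1.1.
rewrite AE prod_normE /= normr0 (_ : Num.max _ _ = `|s - t|)//.
by apply/max_idPl.
Qed.

Let g_strict (eps : R) : 0 < eps -> exists2 d : R, 0 < d & forall y z, `|y - y0| < d ->
  `|z - y0| < d -> `|g y - g z - (y - z) *m B| <= eps * `|y - z|.
Proof.
move=> eps0.
have [d d0 dP] := C1_strictly_differentiable (rV_finite_frame R (k + n)) g_C1 nbhs_img eps0.
exists d => // y z yd zd.
rewrite BE -deriveE; last exact: g_C1.1.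
by apply: dP; rewrite -ball_normE /= distrC.
Qed.

Lemma chart_orbits (eps : R) : 0 < eps ->
  exists2 U, nbhs x U & forall y z, U y -> U z -> F y = F z ->
    exists2 t, `|t| < eps & Phi t y = z.
Proof.
move=> eps0.
have [e /= e0 eW] : nbhs_ball ((0, y0) : 'rV[R]_n * 'rV[R]_(k + n)) W by apply/nbhs_ballP.
have inW t y : `|t| < e -> `|y - y0| < e -> W (t, y).
  by move=> te ye; apply: eW; split; rewrite -ball_normE /= ?sub0r ?normrN// distrC.
have inI y : `|y - y0| < e -> chart_img c y.
  by move=> ye; have [] := inW 0 y; rewrite ?normr0.
(* The time is also kept below [e], so that [Phi t y] stays in the chart and equality of coordinates
   gives equality of points. *)
have me0 : 0 < Num.min eps e by rewrite lt_min eps0.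
have [||d d0 dP] := local_transitivity f_strict g_strict _ _ A_free B_full AB0 me0.
- by exists e => // y /inI/f0.
- by exists e => // t y te ye; rewrite gf//; exact: inW.
pose r := Num.min d e.
have r0 : 0 < r by rewrite lt_min d0.
exists (chart_dom c `&` [set y | `|chart_map c y - y0| < r]).
  apply: filterI; first by apply: open_nbhs_nbhs; split => //; exact: chart_open_dom.
  exact: (cvgrPdistC_lt _ _).1 (chart_map_continuous xc) _ r0.
move=> y z [yc /=] + [zc /=]; rewrite !lt_min => /andP[yd ye] /andP[zd ze] Fyz.
have [|t + ft] := dP _ _ yd zd; first by rewrite /g /= !chart_mapK.
rewrite lt_min => /andP[teps te]; exists t => //.
have [_ /=] := inW t _ te ye; rewrite chart_mapK// => tyc.
by have := congr1 (chart_inv c) ft; rewrite /f /= !chart_mapK.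
Qed.

End Chart.

Lemma local_orbits (x : S) (eps : R) : 0 < eps ->
  exists2 U, nbhs x U & forall y z, U y -> U z -> F y = F z ->
    exists2 t, `|t| < eps & Phi t y = z.
Proof. by have [c cat xc] := mfd_cover x => eps0; apply: (chart_orbits cat xc eps0). Qed.

End LocalOrbits.

(** * The lattice bundle *)

Section Lattice.
Context (R : realType) (k n : nat) (S : regular_integrable_system R k n).
Local Notation Phi := (@ris_Phi R k n S).
Local Notation F := (@ris_F R k n S).

Lemma Phi_comm T U (x : S) : Phi T (Phi U x) = Phi U (Phi T x).
Proof. by rewrite -!ris_PhiD addrC. Qed.

Lemma F_Phi T (x : S) : F (Phi T x) = F x.
Proof. by have := ris_invariant S T => /(congr1 (fun h => h x)). Qed.

Lemma continuous_Phi_l T : continuous (Phi T).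
Proof.
by move=> x; apply: (@continuous_Phi _ _ _ S _ (fun=> T) id); [exact: cvg_cst|].
Qed.

Lemma orbit_projE (x y : S) : orbit_proj x = orbit_proj y <-> exists T, Phi T x = y.
Proof. by split=> [/eqmodP/asboolP|xy]//; apply/eqmodP/asboolP. Qed.

Lemma latticeP T (x : S) : reflect (Phi T x = x) (T \in lattice (orbit_proj x)).
Proof.
apply: (iffP (asboolP _)) => [|Tx y]; first exact.
by move=> /esym/orbit_projE[U <-]; rewrite Phi_comm Tx.
Qed.

Lemma orbit_proj_surj (o : orbit_space S) : exists x, orbit_proj x = o.
Proof. by exists (repr o); exact: reprK. Qed.

Lemma orbit_proj_continuous : continuous (@orbit_proj R k n S).
Proof. exact: pi_continuous. Qed.

(** The projection is open: the saturation of an open set is the union of its preimages under the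
    maps [Phi T]. *)
Lemma nbhs_orbit_proj (x : S) (V : set S) :
  nbhs x V -> nbhs (orbit_proj x) (@orbit_proj R k n S @` V).
Proof.
rewrite {1}nbhsE => -[V' [oV' V'x] V'V]; rewrite nbhsE.
exists (@orbit_proj R k n S @` V'); last exact: image_subset.
split; last by exists x.
(* Openness in the quotient topology is openness of the preimage. *)
change (open (@orbit_proj R k n S @^-1` (@orbit_proj R k n S @` V'))).
suff -> : @orbit_proj R k n S @^-1` (@orbit_proj R k n S @` V') =
    \bigcup_T (Phi T @^-1` V').
  apply: bigcup_open => T _; apply: open_comp oV' => y _.
  exact: continuous_Phi_l.
apply/seteqP; split => [y [z Vz /esym/orbit_projE[T Ty]]|y [T _ Vy]].
  by exists T => //=; rewrite Ty.
by exists (Phi T y) => //; apply/esym/orbit_projE; exists T.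
Qed.

(** For [y] near [x], the point [Phi T y] is close to [y] and on the same fibre of [F]; the short
    time [t] from [local_orbits] closes the path up, and [t + T] is a period. *)
Lemma lattice_lower_semicontinuous (o : orbit_space S) (T : 'rV[R]_n) (eps : R) :
  T \in lattice o -> 0 < eps ->
  \forall o' \near o, exists2 T', T' \in lattice o' & `|T' - T| < eps.
Proof.
have [x <-] := orbit_proj_surj o => /latticeP Tx eps0.
have [U Ux UP] := local_orbits x eps0.
have VU : nbhs x (Phi T @^-1` U).
  by apply: (continuous_Phi_l (x := x)); rewrite Tx.
have := nbhs_orbit_proj (@filterI _ _ (nbhs_filter x) _ _ Ux VU).
apply: filterS => _ [y [Uy UTy] <-].
have [t teps tT] := UP _ _ UTy Uy (F_Phi T y).
by exists (t + T); [apply/latticeP; rewrite ris_PhiD|rewrite addrK].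
Qed.

Lemma not_fixed_near (x : S) T : Phi T x <> x ->
  \forall T' \near T & y \near x, Phi T' y <> y.
Proof.
move=> /eqP Tx.
have := (@mfd_hausdorff _ _ S); rewrite open_hausdorff => /(_ _ _ Tx).
move=> [[A B] /= [TA xB] [oA oB AB]].
have c1 : {for (T, x) : 'rV[R]_n * S, continuous (fun p : 'rV[R]_n * S => Phi p.1 p.2)}.
  exact: Phi_continuous.
have nA : nbhs ((T, x) : 'rV[R]_n * S) [set p | A (Phi p.1 p.2)].
  by apply: c1; apply: open_nbhs_nbhs; split => //; apply/set_mem.
have nB : nbhs ((T, x) : 'rV[R]_n * S) [set p | B p.2].
  apply: (@cvg_snd _ _ (nbhs T) (nbhs x)).
  by apply: open_nbhs_nbhs; split => //; apply/set_mem.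
apply: filterS (filterI nA nB) => -[T' y] /= [Ay By] E.
by move: AB => /eqP; rewrite E in Ay; apply/eqP/set0P; exists y.
Qed.

(** The counterpart of lower semicontinuity: the bundle is closed in the product, because fixed
    points form a closed set in a Hausdorff space. *)
Lemma lattice_closed (o : orbit_space S) T : T \notin lattice o ->
  \forall T' \near T & o' \near o, T' \notin lattice o'.
Proof.
have [x <-] := orbit_proj_surj o => /latticeP/not_fixed_near.
move=> [[A B] /= [TA xB] AB].
exists (A, @orbit_proj R k n S @` B); first by split => //; exact: nbhs_orbit_proj.
by move=> [T' _] /= [AT' [y By <-]]; apply/latticeP; apply: (AB (T', y)).
Qed.

Lemma isotropy_discrete (x : S) :
  exists2 r : R, 0 < r & forall T, Phi T x = x -> `|T| < r -> T = 0.
Proof.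
have := ris_locally_free x => /= /seteqP[_ /(_ 0)]; case; first exact: ris_Phi0.
move=> _ [V /nbhs_ballP[r /= r0 rV] VG]; exists r => // T Tx Tr.
have : (V `&` [set T | Phi T x = x]) T.
  by split => //; apply: rV; rewrite -ball_normE /= sub0r normrN.
by rewrite VG.
Qed.

(** Discreteness at [x] alone gives no bound at nearby points; compactness of a shell of non-periods
    makes [not_fixed_near] uniform. *)
Lemma lattice_uniformly_discrete (o : orbit_space S) :
  exists2 eps : R, 0 < eps & \forall o' \near o,
    forall T, T \in lattice o' -> `|T| < eps -> T = 0.
Proof.
have [x <-] := orbit_proj_surj o; have [r r0 rP] := isotropy_discrete x.
have r40 : 0 < r / 4 by rewrite divr_gt0.
exists (r / 4) => //.
(* A nonzero period shorter than r / 4 would have a multiple in the shell C. *)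
pose C := [set T : 'rV[R]_n | r / 4 <= `|T| <= r / 2].
have Cc : compact C.
  apply: bounded_closed_compact.
    exists (r / 2); split=> [|M rM T /andP[_ Tr]]; first exact: num_real.
    by rewrite /= (le_trans Tr)// ltW.
  have -> : C = (fun T : 'rV[R]_n => `|T|) @^-1` `[r / 4, r / 2]%classic.
    by apply/seteqP; split => T /=; rewrite in_itv.
  by apply: closed_comp => [T _|]; [exact: norm_continuous|exact: itv_closed].
have nearC : \forall y \near x, C `<=` (fun T => Phi T y <> y).
  move/compact_near_coveringP : Cc; apply => T /andP[T1 T2].
  apply: not_fixed_near => Tx; have := rP T Tx.
  rewrite (le_lt_trans T2) ?ltr_pdivrMr ?ltr_pMr ?ltr1n// => /(_ isT) T0.
  by move: T1; rewrite T0 normr0 leNgt r40.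
have := nbhs_orbit_proj nearC; apply: filterS => _ [y Cy <-] T /latticeP Ty Tr.
apply: contrapT => /eqP T0; have nT : 0 < `|T| by rewrite normr_gt0.
have ex : exists m : nat, r / 4 <= `|T| *+ m.
  exists (Num.truncn (r / 4 / `|T|)).+1.
  rewrite -[ `|T| *+ _ ]mulr_natl -ler_pdivrMr// ltW//.
  exact: truncnS_gt.
(* The least multiple reaching [r / 4] exceeds it by less than one step, hence stays below
   [r / 2]. *)
case: (ex_minnP ex) => m Tm mP.
have fixm j : Phi (T *+ j) y = y.
  by elim: j => [|j IH]; rewrite ?mulr0n ?ris_Phi0// mulrS ris_PhiD IH Ty.
apply: (Cy (T *+ m)) (fixm m) => /=.
rewrite /C /= normrMn Tm /=.
case: m Tm mP {fixm} => [|m] Tm mP; first by move: Tm; rewrite mulr0n leNgt r40.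
rewrite mulrS (_ : r / 2 = r / 4 + r / 4); last by field.
rewrite lerD ?(ltW Tr)// ltW// ltNge; apply/negP => /mP.
by rewrite ltnn.
Qed.

(** By compactness all points of the orbit are reached from [x] in time at most some [K]; a vector
    [T] and a bounded time with the same endpoint differ by a period. *)
Lemma lattice_cocompact (o : orbit_space S) :
  exists2 K : R, 0 < K & forall T, exists2 U, U \in lattice o & `|T - U| <= K.
Proof.
have [x <-] := orbit_proj_surj o.
have /compact_near_coveringP := @ris_compact_orbits _ _ _ S x.
(* The bound [K] is the parameter of the near-covering, taken along the filter at infinity so that
   larger bounds remain valid. *)
move=> /(_ R (pinfty_nbhs R) (fun K z => range (Phi ^~ x) z ->
   exists2 t, Phi t x = z & `|t| <= K) _).
case=> [_ [T _ <-]|M [Mreal MP]].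
  have [U Ux UP] := local_orbits (Phi T x) ltr01.
  exists (U, [set K | 1 + `|T| < K]); first split => //.
    by exists (1 + `|T|); split => //; rewrite num_real.
  move=> [z K] /= [Uz TK] [T' _ T'z].
  have [|t t1 tz] := UP _ z (nbhs_singleton Ux) Uz; first by rewrite -T'z !F_Phi.
  exists (t + T); first by rewrite ris_PhiD.
  by rewrite (le_trans (ler_normD _ _))// ltW// (lt_trans _ TK)// ltrD2r.
have KM : M < Num.max 1 (M + 1) by rewrite lt_max ltrDl ltr01 orbT.
exists (Num.max 1 (M + 1)); first by rewrite lt_max ltr01.
move=> T; have [t tT tK] := MP _ KM _ (imageT _ T) (imageT _ T).
exists (T - t); last by rewrite opprB addrC subrK.
by apply/latticeP; rewrite addrC ris_PhiD -tT -ris_PhiD addNr ris_Phi0.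
Qed.

End Lattice.

(** * Homology classes of loops *)

Section Homology.
Context (R : realType) (M : topologicalType).
Local Open Scope quotient_scope.

Let i1 : 'I_3 := Ordinal (isT : (1 < 3)%N).
Let i2 : 'I_3 := Ordinal (isT : (2 < 3)%N).

(* The simplex parametrizes the triangle 0 <= b <= a <= 1 by a = x1 + x2, b = x2. *)
Definition triangle_map (g : R * R -> M) (x : simplex R 2) : M :=
  g ((\val x : 'rV[R]_3) 0 i1 + (\val x : 'rV[R]_3) 0 i2, (\val x : 'rV[R]_3) 0 i2).

Lemma triangle_map_continuous g : continuous g -> continuous (triangle_map g).
Proof.
move=> cg x.
have c (i : 'I_3) : {for x, continuous (fun y : simplex R 2 => (\val y : 'rV[R]_3) 0 i)}.
  apply: (@continuous_comp _ _ _ (fun y : simplex R 2 => \val y : 'rV[R]_3)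
    (fun r : 'rV[R]_3 => r 0 i)); [exact: initial_continuous|exact: coord_continuous].
apply: (@continuous_comp _ _ _ (fun y : simplex R 2 =>
   ((\val y : 'rV[R]_3) 0 i1 + (\val y : 'rV[R]_3) 0 i2, (\val y : 'rV[R]_3) 0 i2)) g);
  last exact: cg.
apply: (@cvg_pair _ _ _ (nbhs x)
    (nbhs ((\val x : 'rV[R]_3) 0 i1 + (\val x : 'rV[R]_3) 0 i2))
    (nbhs ((\val x : 'rV[R]_3) 0 i2)) _ _ _
    (fun y => (\val y : 'rV[R]_3) 0 i1 + (\val y : 'rV[R]_3) 0 i2)
    (fun y => (\val y : 'rV[R]_3) 0 i2)); last exact: c.
by apply: (@cvgD _ _ _ (nbhs x)); exact: c.
Qed.

Definition triangle g (cg : continuous g) : singular_simplex R M 2 :=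
  mkcts (triangle_map_continuous cg).

Lemma simplex1E (x : simplex R 1) :
  (\val x : 'rV[R]_2) 0 ord0 + (\val x : 'rV[R]_2) 0 ord_max = 1.
Proof.
case: x => x /= /set_mem[_]; rewrite !big_ord_recl big_ord0 addr0 => <-.
by congr (_ + x _ _); exact: val_inj.
Qed.

Lemma unlift_val m (i j : 'I_m.+1) (k : 'I_m) : fintype.lift i k = j -> unlift i j = Some k.
Proof. by move=> <-; rewrite liftK. Qed.

(** Faces 0, 1 and 2 are the sides [a = 1], [a = b] and [b = 0], which explains the signs of [p],
    [r] and [q]. *)
Lemma boundary_triangle (g : R * R -> M) (cg : continuous g) (p q r : R -> M)
    (cp : continuous p) (cq : continuous q) (cr : continuous r) :
  (forall s, g (1, s) = p s) -> (forall s, g (s, 0) = q s) -> (forall s, g (s, s) = r s) ->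
  boundary << triangle cg >> = path_chain cp + path_chain cq - path_chain cr.
Proof.
move=> gp gq gr; rewrite /boundary liftU scale1r /boundary_simplex.
rewrite !big_ord_recl big_ord0 addr0 /= expr0 scale1r expr1 scaleN1r.
rewrite exprS expr1 mulrNN mulr1 scale1r addrA addrAC.
have L0 : unlift (ord0 : 'I_3) i1 = Some ord0 by apply: unlift_val; exact: val_inj.
have L1 : unlift (ord0 : 'I_3) i2 = Some ord_max by apply: unlift_val; exact: val_inj.
have L2 : unlift (fintype.lift ord0 ord0 : 'I_3) i1 = None.
  by rewrite (_ : i1 = fintype.lift ord0 ord0) ?unlift_none//; exact: val_inj.
have L3 : unlift (fintype.lift ord0 ord0 : 'I_3) i2 = Some ord_max.
  by apply: unlift_val; exact: val_inj.
have L4 : unlift (fintype.lift ord0 (fintype.lift ord0 ord0) : 'I_3) i1 = Some ord_max.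
  by apply: unlift_val; exact: val_inj.
have L5 : unlift (fintype.lift ord0 (fintype.lift ord0 ord0) : 'I_3) i2 = None.
  by rewrite (_ : i2 = fintype.lift ord0 (fintype.lift ord0 ord0)) ?unlift_none//; exact: val_inj.
congr (<< _ >> + << _ >> - << _ >>); apply/continuousEP => x;
  rewrite /= /mkcts /path_simplex /triangle_map /= !mxE.
- by rewrite L0 L1 simplex1E gp.
- by rewrite L4 L5 addr0 gq.
- by rewrite L2 L3 add0r gr.
Qed.

Definition cycle_class (z : Z1 R M) : H1_mod_torsion R M :=
  \pi_(H1_mod_torsion R M) (\pi_(H1 R M) z).

Lemma cycle_classD z w : cycle_class (z + w) = cycle_class z + cycle_class w.
Proof. by rewrite /cycle_class !raddfD. Qed.

Lemma cycle_classB z w : cycle_class (z - w) = cycle_class z - cycle_class w.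
Proof. by rewrite /cycle_class !raddfB. Qed.

Lemma cycle_class_boundary (z : Z1 R M) :
  (exists b, boundary b = \val z) -> cycle_class z = 0.
Proof.
move=> zb; rewrite /cycle_class.
have -> : \pi_(H1 R M) z = 0.
  rewrite -(raddf0 \pi_(H1 R M)); apply/eqP; rewrite -Quotient.idealrBE subr0.
  exact/asboolP.
exact: raddf0.
Qed.

Lemma mod_torsion_torsionfree (h : H1_mod_torsion R M) (m : nat) :
  (0 < m)%N -> h *+ m = 0 -> h = 0.
Proof.
have pi0 : \pi_(H1_mod_torsion R M) 0 = 0 :> H1_mod_torsion R M by exact: raddf0.
move=> m0; rewrite -[h]reprK; set z := repr h.
have -> : \pi_(H1_mod_torsion R M) z *+ m = \pi_(H1_mod_torsion R M) (z *+ m).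
  by rewrite raddfMn.
rewrite -pi0 => /eqP; rewrite -Quotient.idealrBE subr0 => /asboolP[m' m'0 zm].
apply/eqP; rewrite -Quotient.idealrBE subr0.
by apply/asboolP; exists (m * m')%N; rewrite ?muln_gt0 ?m0// mulrnA.
Qed.

Lemma loop_class_add (p q r : R -> M) (cp : continuous p) (cq : continuous q)
    (cr : continuous r) (p01 : p 0 = p 1) (q01 : q 0 = q 1) (r01 : r 0 = r 1) :
  (exists b, boundary b = path_chain cp + path_chain cq - path_chain cr) ->
  loop_class cr r01 = loop_class cp p01 + loop_class cq q01.
Proof.
pose cyc (p : R -> M) (cp : continuous p) (p01 : p 0 = p 1) : Z1 R M :=
  exist _ (path_chain cp) (path_chain_cycle cp p01).
move=> bP; have := @cycle_class_boundary (cyc p cp p01 + cyc q cq q01 - cyc r cr r01) bP.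
by rewrite cycle_classB cycle_classD => /eqP; rewrite subr_eq0 => /eqP/esym.
Qed.

Lemma loop_class_eq (p q : R -> M) (cp : continuous p) (cq : continuous q)
    (p01 : p 0 = p 1) (q01 : q 0 = q 1) :
  (exists b, boundary b = path_chain cp - path_chain cq) ->
  loop_class cp p01 = loop_class cq q01.
Proof.
pose cyc (p : R -> M) (cp : continuous p) (p01 : p 0 = p 1) : Z1 R M :=
  exist _ (path_chain cp) (path_chain_cycle cp p01).
move=> bP; have := @cycle_class_boundary (cyc p cp p01 - cyc q cq q01) bP.
by rewrite cycle_classB => /eqP; rewrite subr_eq0 => /eqP.
Qed.

Lemma loop_class_homotopy (H : R * R -> M) (p q : R -> M) (cp : continuous p)
    (cq : continuous q) (p01 : p 0 = p 1) (q01 : q 0 = q 1) :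
  continuous H -> (forall s, H (s, 0) = p s) -> (forall s, H (s, 1) = q s) ->
  (forall t, H (0, t) = H (1, t)) -> loop_class cp p01 = loop_class cq q01.
Proof.
move=> cH Hp Hq H01.
have c1 (f : R -> R * R) : continuous f -> continuous (H \o f).
  by move=> cf s; apply: continuous_comp; [exact: cf|exact: cH].
have cdiag : continuous (fun s : R => H (s, s)).
  apply: (c1 (fun s => (s, s))) => s.
  by apply: (@cvg_pair _ _ _ (nbhs s) (nbhs s) (nbhs s) _ _ _ id id); exact: cvg_id.
have cside : continuous (fun s : R => H (1, s)).
  apply: (c1 (fun s => (1, s))) => s.
  by apply: (@cvg_pair _ _ _ (nbhs s) (nbhs (1 : R)) (nbhs s) _ _ _ (fun=> 1) id);
    [exact: cvg_cst|exact: cvg_id].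
have cswap : continuous (fun s : R * R => H (s.2, s.1)).
  move=> s; apply: (@continuous_comp _ _ _ (fun s : R * R => (s.2, s.1)) H); last exact: cH.
  by apply: (@cvg_pair _ _ _ (nbhs s) (nbhs s.2) (nbhs s.1) _ _ _ snd fst);
    [exact: cvg_snd|exact: cvg_fst].
(* The square is cut along its diagonal. *)
have b1 := boundary_triangle cH cside cp cdiag (fun=> erefl) Hp (fun=> erefl).
have b2 := boundary_triangle cswap cq cside cdiag Hq (fun s => H01 s) (fun=> erefl).
(* The diagonal and the common side [H (0, t) = H (1, t)] occur in both boundaries and cancel. *)
apply: loop_class_eq; exists (<< triangle cH >> - << triangle cswap >>).
rewrite raddfB /= b1 b2 opprB addrA subrK [path_chain cside + _]addrC.
by rewrite [path_chain cq + _]addrC opprD addrA addrK.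
Qed.

End Homology.

(** * Homology classes of periods *)

Section PeriodClass.
Context (R : realType) (k n : nat) (S : regular_integrable_system R k n).
Local Notation Phi := (@ris_Phi R k n S).
Local Notation H := (H1_mod_torsion R S).

Lemma orbit_loop_periodic T (x : S) : Phi T x = x -> orbit_loop T x 0 = orbit_loop T x 1.
Proof. by move=> Tx; rewrite /orbit_loop scale0r scale1r ris_Phi0 Tx. Qed.

(** The default 0 makes the class a total function of vector and point, so that it can be used
    without carrying proofs of periodicity. *)
Definition period_class (T : 'rV[R]_n) (x : S) : H :=
  if pselect (Phi T x = x) is left Tx
  then loop_class (@orbit_loop_continuous R k n S T x) (orbit_loop_periodic Tx) else 0.

Lemma period_classE T x (cp : continuous (@orbit_loop R k n S T x))
    (e : orbit_loop T x 0 = orbit_loop T x 1) :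
  period_class T x = loop_class cp e.
Proof.
rewrite /period_class; case: pselect => [Tx|[]]; first by congr loop_class; exact: Prop_irrelevance.
by move: e; rewrite /orbit_loop scale0r scale1r ris_Phi0.
Qed.

Lemma period_class_homotopy (tau : R -> 'rV[R]_n) (gamma : R -> S) :
  continuous tau -> continuous gamma -> (forall t, Phi (tau t) (gamma t) = gamma t) ->
  period_class (tau 0) (gamma 0) = period_class (tau 1) (gamma 1).
Proof.
move=> ctau cgamma fixg.
rewrite !(period_classE (@orbit_loop_continuous R k n S _ _) (orbit_loop_periodic (fixg _))).
apply: (@loop_class_homotopy _ _ (fun p : R * R => Phi (p.1 *: tau p.2) (gamma p.2))) => //.
  move=> p; apply: (@continuous_Phi _ _ _ S _ (fun p : R * R => p.1 *: tau p.2)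
    (fun p : R * R => gamma p.2)).
    apply: (@cvgZ _ _ _ (nbhs p)); first exact: cvg_fst.
    apply: (@continuous_comp _ _ _ (fun p : R * R => p.2) tau); [exact: cvg_snd|exact: ctau].
  by apply: (@continuous_comp _ _ _ (fun p : R * R => p.2) gamma); [exact: cvg_snd|exact: cgamma].
by move=> t /=; rewrite scale0r scale1r ris_Phi0 fixg.
Qed.

Lemma period_class_orbit T U x : Phi T x = x ->
  period_class T (Phi U x) = period_class T x.
Proof.
move=> Tx; have := @period_class_homotopy (fun=> T) (fun t => Phi (t *: U) x).
rewrite /= scale0r scale1r ris_Phi0 => -> //.
- by move=> t; exact: cvg_cst.
- exact: (@orbit_loop_continuous R k n S U x).
- by move=> t; rewrite Phi_comm Tx.
Qed.

Lemma bundle_vec_lattice (v : lattice_bundle S) : bundle_vec v \in lattice (bundle_proj v).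
Proof. by case: v => -[b T] /= vP; have := set_mem vP. Qed.

Lemma rho_period_class (v : lattice_bundle S) x : orbit_proj x = bundle_proj v ->
  rho S v = period_class (bundle_vec v) x.
Proof.
move=> xv; have vx : Phi (bundle_vec v) (repr (bundle_proj v)) = repr (bundle_proj v).
  by apply/latticeP; rewrite /orbit_proj reprK bundle_vec_lattice.
have /esym/orbit_projE[U Ux] : orbit_proj x = orbit_proj (repr (bundle_proj v)).
  by rewrite xv /orbit_proj reprK.
rewrite -Ux period_class_orbit//.
by rewrite /rho /loop_class_at (period_classE (@orbit_loop_continuous R k n S _ _)
  (orbit_loop_closed (reprK (bundle_proj v)))).
Qed.

(** The triangle [Phi (a T + b U) x] has [T + U] as diagonal, [T] as the side [b = 0], and [U] as
    the side [a = 1] because [T] fixes [x]. *)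
Lemma period_classD T U x : Phi T x = x -> Phi U x = x ->
  period_class (T + U) x = period_class T x + period_class U x.
Proof.
move=> Tx Ux; have TUx : Phi (T + U) x = x by rewrite ris_PhiD Ux.
rewrite (period_classE (@orbit_loop_continuous R k n S _ _) (orbit_loop_periodic Tx)).
rewrite (period_classE (@orbit_loop_continuous R k n S _ _) (orbit_loop_periodic Ux)).
rewrite (period_classE (@orbit_loop_continuous R k n S _ _) (orbit_loop_periodic TUx)).
pose g (p : R * R) := Phi (p.1 *: T + p.2 *: U) x.
have cg : continuous g.
  move=> p; apply: (@continuous_Phi _ _ _ S _ (fun p : R * R => p.1 *: T + p.2 *: U)
    (fun=> x)); last exact: cvg_cst.
  by apply: (@cvgD _ _ _ (nbhs p)); apply: (@cvgZr_tmp _ _ _ (nbhs p));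
    [exact: cvg_fst|exact: cvg_snd].
rewrite [RHS]addrC; apply: loop_class_add.
exists (<< triangle cg >>); apply: boundary_triangle => s; rewrite /g /orbit_loop /=.
- by rewrite scale1r addrC ris_PhiD Tx.
- by rewrite scale0r addr0.
- by rewrite scalerDr.
Qed.

End PeriodClass.

Lemma clamp_continuous (R : realType) (a b : R) :
  continuous (fun t : R => Num.max a (Num.min b t)).
Proof.
move=> t.
have h : {for t, continuous ((cst b : R -> R^o) \min id)}.
  by apply: continuous_min; [exact: cvg_cst|exact: cvg_id].
by apply: (@continuous_max _ _ (cst a) ((cst b : R -> R^o) \min id) t); [exact: cvg_cst|].
Qed.

(** * Local sections of the lattice bundle *)

Section LocalSections.
Context (R : realType) (k n : nat) (S : regular_integrable_system R k n).
Local Notation Phi := (@ris_Phi R k n S).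
Local Notation O := (orbit_space S).

(** Straight segments in a chart, with the parameter clamped so that the path is defined and stays
    in [V] for all real times. *)
Lemma locally_path_connected (x : S) (V : set S) : nbhs x V ->
  exists2 V', nbhs x V' & forall y, V' y -> exists gamma : R -> S,
    [/\ continuous gamma, gamma 0 = x, gamma 1 = y & forall t, V (gamma t)].
Proof.
move=> Vx; have [c _ xc] := mfd_cover x.
set y0 := chart_map c x; have y0c : chart_img c y0 by exists x.
have : nbhs y0 (chart_img c `&` (chart_inv c @^-1` V)).
  apply: filterI; first by apply: open_nbhs_nbhs; split => //; exact: chart_open_img.
  by apply: (chart_inv_continuous y0c); rewrite chart_mapK.
move=> /nbhs_ballP[r /= r0 rV].
exists (chart_dom c `&` [set y | `|chart_map c y - y0| < r]).
  apply: filterI; first by apply: open_nbhs_nbhs; split => //; exact: chart_open_dom.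
  exact: (cvgrPdistC_lt _ _).1 (chart_map_continuous xc) _ r0.
move=> y [yc /= yr].
pose clamp (t : R) := Num.max 0 (Num.min 1 t).
have cclamp : continuous clamp.
  exact: clamp_continuous.
have clampP t : 0 <= clamp t <= 1.
  by rewrite le_max lexx /= ge_max ler01 ge_min lexx.
pose u t := y0 + clamp t *: (chart_map c y - y0).
have uB t : ball y0 r (u t).
  rewrite -ball_normE /= /u opprD addNKr normrN normrZ.
  have /andP[t0 t1] := clampP t; rewrite ger0_norm//.
  by rewrite (le_lt_trans _ yr)// ler_piMl.
exists (fun t => chart_inv c (u t)); split.
- move=> t; apply: (@continuous_comp _ _ _ u (chart_inv c)).
    apply: (@cvgD _ _ _ (nbhs t)); first exact: cvg_cst.
    by apply: (@cvgZr_tmp _ _ _ (nbhs t)); exact: cclamp.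
  by apply: chart_inv_continuous; have [] := rV _ (uB t).
- by rewrite /u /clamp /Num.min ltr10 maxxx scale0r addr0 chart_mapK.
- by rewrite /u /clamp minxx max_r// scale1r addrC subrK chart_mapK.
- by move=> t; have [] := rV _ (uB t).
Qed.

(** Lower semicontinuity gives a period near [T], and uniform discreteness makes it unique, since
    [r] is at most half the separation [d]. *)
Lemma lattice_local_section (o : O) T (e : R) : T \in lattice o -> 0 < e ->
  exists (r : R) (U : set O) (s : O -> 'rV[R]_n),
  [/\ 0 < r <= e, open_nbhs o U,
      forall o', U o' -> s o' \in lattice o' /\ `|s o' - T| < r,
      forall o' T', U o' -> T' \in lattice o' -> `|T' - T| < r -> T' = s o' &
      forall o', U o' -> {for o', continuous s}].
Proof.
move=> To e0; have [d d0 dP] := lattice_uniformly_discrete o.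
pose r := Num.min e (d / 2).
have r0 : 0 < r by rewrite lt_min e0 divr_gt0.
have rd : r + r <= d by rewrite [leRHS]splitr lerD// ge_min lexx orbT.
have : nbhs o ([set o' | forall T, T \in lattice o' -> `|T| < d -> T = 0] `&`
    [set o' | exists2 T', T' \in lattice o' & `|T' - T| < r]).
  by apply: filterI => //; exact: lattice_lower_semicontinuous.
rewrite nbhsE /= => -[U [oU Uo] UP].
pose s (o' : O) := xget 0 [set T' | T' \in lattice o' /\ `|T' - T| < r].
have sP o' : U o' -> s o' \in lattice o' /\ `|s o' - T| < r.
  by move=> /UP[_ [T' T'o' T'T]]; rewrite /s; case: xgetP => [? -> //|/(_ T')]; case.
have sU o' T' : U o' -> T' \in lattice o' -> `|T' - T| < r -> T' = s o'.
  move=> Uo' T'o' T'T; have [so' sT] := sP _ Uo'; have [+ _] := UP _ Uo'.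
  move=> /(_ (T' - s o') (rpredB T'o' so')) H; apply/eqP; rewrite -subr_eq0; apply/eqP/H.
  have -> : T' - s o' = (T' - T) - (s o' - T) by rewrite opprB addrA subrK.
  by rewrite (lt_le_trans _ rd)// (le_lt_trans (ler_normB _ _))// ltrD.
have re : 0 < r <= e by rewrite r0 ge_min lexx.
exists r, U, s; split => //.
move=> o' Uo'; have [so' sT] := sP _ Uo'.
apply/(@cvgrPdist_lt _ _ _ (nbhs o') (nbhs_filter o')) => eta eta0.
(* The second bound keeps a period near [s o'] within [r] of [T], where uniqueness identifies it
   with [s o'']. *)
have m0 : 0 < Num.min eta (r - `|s o' - T|) by rewrite lt_min eta0 subr_gt0.
have nU : nbhs o' U by exact: open_nbhs_nbhs.
near=> o''.
have Uo'' : U o'' by near: o''.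
have : exists2 T'', T'' \in lattice o'' & `|T'' - s o'| < Num.min eta (r - `|s o' - T|).
  by near: o''; exact: lattice_lower_semicontinuous.
move=> [T'' T''o'']; rewrite lt_min => /andP[T''eta T''r].
suff <- : T'' = s o'' by rewrite distrC.
apply: sU => //; have -> : T'' - T = (T'' - s o') + (s o' - T) by rewrite addrA subrK.
by rewrite (le_lt_trans (ler_normD _ _))// -ltrBrDr.
Unshelve. all: by end_near. Qed.

Definition period_class_at (o : O) T := period_class T (repr o : S).

Lemma period_class_atE x T : Phi T x = x ->
  period_class_at (orbit_proj x) T = period_class T x.
Proof.
move=> Tx; rewrite /period_class_at.
have /orbit_projE[U <-] : orbit_proj x = orbit_proj (repr (orbit_proj x)).
  by rewrite {2}/orbit_proj reprK.
exact: period_class_orbit.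
Qed.

(** The neighbourhood is shrunk until each of its orbits is joined to [o] by a path in the manifold
    lying over the domain of [s]; along this path [s] gives a homotopy of loops. *)
Lemma period_class_at_local_section (o : O) T (e : R) : T \in lattice o -> 0 < e ->
  exists (r : R) (U : set O) (s : O -> 'rV[R]_n),
  [/\ 0 < r <= e, open_nbhs o U,
      forall o', U o' -> [/\ s o' \in lattice o', `|s o' - T| < r &
        period_class_at o' (s o') = period_class_at o T],
      forall o' T', U o' -> T' \in lattice o' -> `|T' - T| < r -> T' = s o' &
      forall o', U o' -> {for o', continuous s}].
Proof.
move=> To e0.
have [r [U [s [r0 oU sP sU cs]]]] := lattice_local_section To e0.
have [x xo] := orbit_proj_surj o.
have Ux : nbhs x (@orbit_proj R k n S @^-1` U).
  by apply: orbit_proj_continuous; rewrite xo; exact: open_nbhs_nbhs.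
have [V Vx VP] := locally_path_connected Ux.
have := nbhs_orbit_proj Vx; rewrite xo nbhsE => -[U' [oU' U'o] U'V].
exists r, (U `&` U'), s; split => //.
- by case: oU => oU Uo; split; [exact: openI|].
- move=> o' [Uo' /U'V [y Vy yo']]; have [so' sT] := sP _ Uo'; split => //.
  have [gamma [cg g0 g1 gU]] := VP _ Vy.
  have := @period_class_homotopy _ _ _ S (fun t => s (orbit_proj (gamma t))) gamma.
  have sT' : s o = T.
    apply/esym/sU => //; first by case: oU.
    by rewrite subrr normr0; case/andP: r0.
  rewrite g0 g1 yo' xo sT' => E.
  rewrite -xo -{1}yo' !period_class_atE; [symmetry; apply: E| |].
  + move=> t; apply: (@continuous_comp _ _ _ gamma (fun z => s (orbit_proj z))).
      exact: cg.
    apply: (@continuous_comp _ _ _ (@orbit_proj R k n S) s).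
      exact: orbit_proj_continuous.
    by apply: cs; exact: gU.
  + exact: cg.
  + by move=> t; apply/latticeP; have [] := sP _ (gU t).
  + by apply/latticeP; rewrite xo.
  + by apply/latticeP; rewrite yo'.
- by move=> o' T' [Uo' _]; exact: sU.
- by move=> o' [Uo' _]; exact: cs.
Qed.

End LocalSections.

(** * Subgroups of finite rank *)

Section IntegralCombinations.
Context (H : zmodType).

Definition zcomb N (e : 'I_N -> H) (c : 'rV[int]_N) : H := \sum_j e j *~ c 0 j.

Fact zcomb_is_zmod_morphism N (e : 'I_N -> H) : GRing.zmod_morphism (zcomb e).
Proof.
by move=> c c'; rewrite /zcomb -sumrB; apply: eq_bigr => j _; rewrite !mxE mulrzBr.
Qed.
HB.instance Definition _ N e :=
  GRing.isZmodMorphism.Build 'rV[int]_N H (zcomb e) (zcomb_is_zmod_morphism e).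

Lemma zcomb_mulmx N p (e : 'I_N -> H) (c : 'rV[int]_p) (A : 'M[int]_(p, N)) :
  zcomb e (c *m A) = zcomb (fun i => zcomb e (row i A)) c.
Proof.
rewrite /zcomb; under eq_bigr => j _ do rewrite mxE mulrz_sumr.
rewrite exchange_big /=; apply: eq_bigr => i _.
rewrite mulrz_suml; apply: eq_bigr => j _.
by rewrite mxE mulrC mulrzA.
Qed.

Lemma zcomb_delta N (e : 'I_N -> H) i : zcomb e (delta_mx 0 i) = e i.
Proof.
rewrite /zcomb (bigD1 i)//= mxE !eqxx mulr1z big1 ?addr0// => j ji.
by rewrite mxE eqxx (negbTE ji) mulr0z.
Qed.

Hypothesis torsionfree : forall (h : H) (m : nat), (0 < m)%N -> h *+ m = 0 -> h = 0.

Lemma torsionfree_int (h : H) (m : int) : m != 0 -> h *~ m = 0 -> h = 0.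
Proof.
case: m => m m0; first by apply: torsionfree; rewrite lt0n.
rewrite NegzE mulrNz => /eqP; rewrite oppr_eq0 => /eqP; exact: torsionfree.
Qed.

(* The Smith normal form of the row c provides a basis change Q such that c is a
   multiple of the first row of Q; the generator given by this row is torsion. *)
Lemma zcomb_reduce N (e : 'I_N.+1 -> H) (c : 'rV[int]_N.+1) : c != 0 -> zcomb e c = 0 ->
  exists A : 'M[int]_(N, N.+1), forall d, exists d',
    zcomb e d = zcomb (fun i => zcomb e (row i A)) d'.
Proof.
move=> c0 ec; have [L uL [Q uQ [ds _ cE]]] := int_Smith_normal_form c.
pose e' i := zcomb e (row i Q).
(* The left factor of a single row is one by one, so the diagonal form leaves one entry [a], nonzero
   because [c] is. *)
pose a := L 0 0 * ds`_0.
have cE' : c = (a *: delta_mx 0 0) *m Q.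
  rewrite {1}cE; congr (_ *m _); apply/rowP => j.
  rewrite !mxE big_ord1 !mxE eqxx /= /a eq_sym.
  by rewrite -[(j : nat) == _]/(j == 0); case: (j == 0); rewrite ?mulr1 ?mulr0.
have a0 : a != 0 by apply: contraNneq c0 => a0; rewrite cE' a0 scale0r mul0mx.
have e'0 : e' 0 = 0.
  apply: (torsionfree_int a0); rewrite -ec cE' zcomb_mulmx -/e'.
  rewrite /zcomb (bigD1 0)//= !mxE !eqxx mulr1 big1 ?addr0// => j j0.
  by rewrite !mxE eqxx (negbTE j0) mulr0 mulr0z.
(* The remaining rows of [Q] suffice, as the first contributes zero to every combination. *)
exists (\matrix_(i, j) Q (fintype.lift 0 i) j) => d.
exists (\row_i (d *m invmx Q) 0 (fintype.lift 0 i)).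
rewrite -{1}[d](mulmxKV uQ) zcomb_mulmx -/e' {1}/zcomb big_ord_recl e'0 mul0rz add0r.
apply: eq_bigr => i _; rewrite [in RHS]mxE; congr (zcomb _ _ *~ _).
by apply/rowP => j; rewrite !mxE.
Qed.

(** Induction on the number of generators: a nontrivial relation allows one of them to be
    eliminated. *)
Lemma zcomb_basis N (g : 'I_N -> H) : exists l (e : 'I_l -> H),
  [/\ forall i, exists c, e i = zcomb g c,
      forall d, exists d', zcomb g d = zcomb e d' & injective (zcomb e)].
Proof.
elim: N g => [|N IH] g.
  exists 0%N, g; split; [by case|by move=> d; exists d|].
  by move=> c d _; apply/rowP => -[].
have [[c /andP[c0 /eqP gc]]|gfree] := pselect (exists c, (c != 0) && (zcomb g c == 0)).
  have [A gA] := zcomb_reduce c0 gc.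
  have [l [e [eg ge einj]]] := IH (fun i => zcomb g (row i A)).
  exists l, e; split => // [i|d].
    by have [a ->] := eg i; exists (a *m A); rewrite zcomb_mulmx.
  by have [d' ->] := gA d; exact: ge.
exists N.+1, g; split => [i|d|c d cd]; [|by exists d|].
  by exists (delta_mx 0 i); rewrite zcomb_delta.
apply/eqP; rewrite -subr_eq0; apply/negPn/negP => cd0; apply: gfree.
by exists (c - d); rewrite cd0 raddfB /= cd subrr eqxx.
Qed.

End IntegralCombinations.

(** * Generation and rank of discrete subgroups *)

Section DiscreteSubgroups.
Context (R : realType) (n : nat) (L : zmodClosed 'rV[R]_n).

(** A vector is approached in steps of length 1/2 from 0; the lattice approximants of successive
    points differ by short elements. Density is required only on a bounded set and with slack 1/2,
    so that it passes from one fibre to the nearby ones. *)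
Lemma bounded_generation (K : R) (P : 'rV[R]_n -> Prop) :
  0 <= K ->
  (forall T : 'rV[R]_n, `|T| <= K + 1 -> exists2 U, U \in L & `|T - U| <= K + 2^-1) ->
  P 0 -> (forall T U, T \in L -> U \in L -> P T -> P U -> P (T + U)) ->
  (forall T, T \in L -> `|T| <= K + K + 2 -> P T) ->
  forall T, T \in L -> P T.
Proof.
move=> K0 dense P0 PD Psmall.
have claim (m : nat) (T : 'rV[R]_n) : `|T| <= m%:R / 2 ->
    exists U, [/\ U \in L, P U & `|T - U| <= K + 2^-1].
  elim: m T => [|m IH] T Tm.
    exists 0; rewrite subr0 rpred0; split => //.
    by rewrite (le_trans Tm)// mul0r addr_ge0// invr_ge0.
  have m1 : 0 < m.+1%:R :> R by rewrite ltr0n.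
  pose T' := (m%:R / m.+1%:R) *: T.
  have [|U [UL PU T'U]] := IH T'.
    rewrite normrZ ger0_norm ?divr_ge0//.
    rewrite (le_trans (ler_wpM2l _ Tm)) ?divr_ge0//.
    by rewrite mulrA divfK ?gt_eqF.
  have TT' : `|T - T'| <= 2^-1.
    have -> : T - T' = m.+1%:R^-1 *: T.
      rewrite /T' -{1}[T]scale1r -scalerBl; congr (_ *: _).
      by rewrite -[X in X - _](@mulfV _ m.+1%:R) ?gt_eqF// -mulrBl -natr1 addrC addKr mul1r.
    rewrite normrZ ger0_norm ?invr_ge0// (le_trans (ler_wpM2l _ Tm)) ?invr_ge0//.
    by rewrite mulrA mulVf ?gt_eqF// mul1r.
  have TU : `|T - U| <= K + 1.
    have -> : T - U = (T - T') + (T' - U) by rewrite addrA subrK.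
    rewrite (le_trans (ler_normD _ _))// (le_trans (lerD TT' T'U))//; lra.
  have [V VL TUV] := dense _ TU.
  exists (U + V); split; [exact: rpredD| |by rewrite opprD addrA].
  apply: PD => //; apply: Psmall => //.
  have -> : V = (T - U) - (T - U - V) by rewrite subKr.
  rewrite (le_trans (ler_normB _ _))// (le_trans (lerD TU TUV))//; lra.
(* For [T] in [L] the remaining error [T - U] is itself a short element of [L]. *)
move=> T TL; pose m := (Num.truncn (2 * `|T|)).+1.
have [|U [UL PU TU]] := claim m T.
  by rewrite ler_pdivlMr// mulrC ltW// truncnS_gt.
rewrite -(subrK U T); apply: PD => //; first exact: rpredB.
apply: Psmall; first exact: rpredB.
by rewrite (le_trans TU)//; lra.
Qed.

(* Pigeonhole: the N ^ l combinations of the T i with coefficients below N fall into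
   distinct boxes of side d, of which a ball of radius O(N) meets only O(N ^ n). *)
Lemma discrete_rank (d : R) l (T : 'I_l -> 'rV[R]_n) :
  0 < d -> (forall U, U \in L -> `|U| < d -> U = 0) -> (forall i, T i \in L) ->
  injective (zcomb T) -> (l <= n)%N.
Proof.
move=> d0 disc TL Tinj; rewrite leqNgt; apply/negP => nl.
pose C := 1 + \sum_i `|T i|.
have C0 : 0 < C by rewrite ltr_pwDl// sumr_ge0.
pose D := (Num.truncn (2 * C / d)).+1.
have DP : 2 * C / d < D%:R by exact: truncnS_gt.
(* Chosen so that the number of boxes [(D * N) ^ n] is below [N ^ n.+1], hence below [N ^ l]. *)
pose N := (D ^ n).+1.
pose v (f : {ffun 'I_l -> 'I_N}) := zcomb T (\row_i (f i)%:Z).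
have vL f : v f \in L by apply: rpred_sum => i _; rewrite rpredMz.
have vB f j : `|v f 0 j| <= C * N%:R.
  rewrite (le_trans (coord_le_norm _ _))// /v /zcomb (le_trans (ler_norm_sum _ _ _))//.
  rewrite mulrDl mul1r ler_wpDl// mulr_suml ler_sum// => i _.
  rewrite mxE -pmulrn normrMn -[_ *+ nat_of_ord _]mulr_natr ler_wpM2l// ler_nat.
  exact/ltnW/ltn_ord.
(* Coordinates in units of [d], shifted to be nonnegative so that truncation is the floor. *)
pose y f j := (v f 0 j + C * N%:R) / d.
have y0 f j : 0 <= y f j.
  by rewrite divr_ge0 ?(ltW d0)// -lerBlDr sub0r; have := vB f j; rewrite ler_norml => /andP[].
have yD f j : (Num.truncn (y f j) < D * N)%N.
  rewrite truncn_lt_nat//; have := vB f j; rewrite ler_norml => /andP[_ vC].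
  apply: (@le_lt_trans _ _ (2 * C / d * N%:R)).
    rewrite /y mulrAC ler_pM2r ?invr_gt0//; lra.
  by rewrite natrM ltr_pM2r// ltr0n.
pose b (f : {ffun 'I_l -> 'I_N}) : {ffun 'I_n -> 'I_(D * N)} := [ffun j => Ordinal (yD f j)].
have binj : injective b.
  move=> f g /ffunP fg; suff /Tinj /rowP E : v f = v g.
    by apply/ffunP => i; have := E i; rewrite !mxE => -[] /val_inj.
  apply/eqP; rewrite -subr_eq0; apply/eqP/disc; first exact: rpredB.
  rewrite [ltLHS]/Num.Def.normr /= mx_normrE; apply/bigmax_ltP; split => // -[i j] _ /=.
  rewrite ord1 !mxE.
  have := congr1 val (fg j); rewrite !ffunE /= => yfg.
  have := truncn_itv (y0 f j); have := truncn_itv (y0 g j); rewrite yfg.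
  set m := Num.truncn _ => /andP[g1 g2] /andP[f1 f2].
  have -> : v f 0 j - v g 0 j = (y f j - y g j) * d.
    by rewrite /y -mulrBl divfK ?gt_eqF// opprD addrACA subrr addr0.
  rewrite normrM (gtr0_norm d0) gtr_pMl// ltr_norml.
  rewrite -natr1 in g2 f2; apply/andP; split; lra.
have := leq_card b binj; rewrite !card_ffun !card_ord leqNgt => /negP; apply.
apply: (@leq_trans (N ^ n.+1)); last by rewrite leq_exp2l// /N ltnS expn_gt0.
by rewrite expnMn expnS ltn_mul2r expn_gt0 /=.
Qed.

End DiscreteSubgroups.

(** * Local triviality of the lattice bundle *)

Lemma connected_locally_constant (X : topologicalType) (Q : X -> Prop) :
  connected [set: X] -> (forall x, \forall y \near x, Q y <-> Q x) ->
  forall x y, Q x -> Q y.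
Proof.
move=> cX locQ x y Qx.
have oQ : open [set z | Q z].
  by rewrite openE => z /= Qz; apply: filterS (locQ z) => w /= [_]; exact.
have oNQ : open [set z | ~ Q z].
  rewrite openE => z /= Qz; apply: filterS (locQ z) => w /= [QwQz _] Qw.
  exact/Qz/QwQz.
suff : [set z | Q z] = setT by move=> /seteqP[_ /(_ y)]; apply.
apply: cX; first by exists x.
  by exists [set z | Q z]; rewrite ?setTI.
by exists [set z | Q z]; rewrite ?setTI// -openC.
Qed.

Section Covering.
Context (R : realType) (k n : nat) (S : regular_integrable_system R k n).
Local Notation O := (orbit_space S).
Local Notation H := (H1_mod_torsion R S).

Lemma period_class_atD (o : O) T U : T \in lattice o -> U \in lattice o ->
  period_class_at o (T + U) = period_class_at o T + period_class_at o U.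
Proof.
have [x <-] := orbit_proj_surj o => /latticeP Tx /latticeP Ux.
have TUx : ris_Phi (T + U) x = x by rewrite ris_PhiD Ux.
by rewrite !period_class_atE// period_classD.
Qed.

Lemma period_class_at0 (o : O) : period_class_at o 0 = 0.
Proof.
apply: (addrI (period_class_at o 0)).
by rewrite -period_class_atD ?rpred0// !addr0.
Qed.

Lemma period_class_atB (o : O) T U : T \in lattice o -> U \in lattice o ->
  period_class_at o (T - U) = period_class_at o T - period_class_at o U.
Proof.
move=> To Uo; apply: (addIr (period_class_at o U)).
by rewrite -period_class_atD ?rpredB// !subrK.
Qed.

(** The class is recorded with the section, so that extension of periods and constancy of their
    classes are proved in one induction. *)
Definition flat_section (U : set O) (s : O -> 'rV[R]_n) (c : H) :=
  forall o, U o -> [/\ s o \in lattice o, period_class_at o (s o) = c & {for o, continuous s}].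

Lemma flat_sectionS (U V : set O) s c : U `<=` V -> flat_section V s c -> flat_section U s c.
Proof. by move=> UV sc o /UV/sc. Qed.

Lemma flat_section0 U : flat_section U (fun=> 0) 0.
Proof. by move=> o _; split; [exact: rpred0|exact: period_class_at0|exact: cst_continuous]. Qed.

Lemma flat_sectionD U s t c d : flat_section U s c -> flat_section U t d ->
  flat_section U (fun o => s o + t o) (c + d).
Proof.
move=> sc td o Uo; have [so <- cs] := sc _ Uo; have [to <- ct] := td _ Uo.
split; [exact: rpredD|exact: period_class_atD|].
by apply: (@cvgD _ _ _ (nbhs o)).
Qed.

(** Formulated for every vector [T], period or not, so that a compact ball can be covered. Near a
    vector that is not a period there are no periods, and both claims are vacuous. *)
Lemma lattice_local_data (o : O) (T : 'rV[R]_n) : exists p : R * set O,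
  [/\ 0 < p.1, nbhs o p.2,
    forall o' T', p.2 o' -> `|T' - T| < p.1 -> T' \in lattice o' ->
      T \in lattice o /\ exists2 s, flat_section p.2 s (period_class_at o T) & s o' = T' &
    forall o' T', p.2 o' -> `|T' - T| < p.1 -> T' \in lattice o ->
      exists2 T'', T'' \in lattice o' & `|T' - T''| <= 2^-1].
Proof.
have [To|To] := boolP (T \in lattice o).
  (* Two vectors within 1/4 of [T] differ by at most the slack 1/2 of [bounded_generation]. *)
  have e0 : 0 < 4^-1 :> R by rewrite invr_gt0.
  have [r [U [s [/andP[r0 r4] Uo sP sU cs]]]] := period_class_at_local_section To e0.
  exists (r, U); split => //=; first exact: open_nbhs_nbhs.
    move=> o' T' Uo' T'T T'o'; split => //; exists s; last by rewrite -(sU o' T').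
    by move=> o'' Uo''; have [? ? ?] := sP _ Uo''; split => //; exact: cs.
  move=> o' T' Uo' T'T _; have [so' sT _] := sP _ Uo'; exists (s o') => //.
  have -> : T' - s o' = (T' - T) - (s o' - T) by rewrite opprB addrA subrK.
  rewrite (le_trans (ler_normB _ _))// (_ : 2^-1 = 4^-1 + 4^-1); last by field.
  by rewrite lerD// (le_trans (ltW _) r4).
have [[A B] /= [/nbhs_ballP[r /= r0 rA] oB] AB] := lattice_closed To.
exists (r, B); split => //= o' T' Bo' T'T T'o.
  have /= := AB (T', o'); rewrite T'o => H'; exfalso.
  suff : ~~ true by [].
  by apply: H'; split => //=; apply: rA; rewrite -ball_normE /= distrC.
have /= := AB (T', o); rewrite T'o => H'; exfalso.
suff : ~~ true by [].
apply: H'; split => /=; last exact: nbhs_singleton.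
by apply: rA; rewrite -ball_normE /= distrC.
Qed.

(** The domain of a local section depends on its period. Compactness of the ball of radius [2 K + 2]
    gives one [U] for all short periods over points of [U], and sums of short periods give all the
    others. *)
Lemma lattice_covering (o : O) : exists U : set O,
  [/\ open_nbhs o U,
    forall o' T, U o' -> T \in lattice o' ->
      exists2 s, flat_section U s (period_class_at o' T) & s o' = T &
    exists N (g : 'I_N -> 'rV[R]_n), (forall i, g i \in lattice o) /\
      forall T, T \in lattice o -> exists c,
        period_class_at o T = zcomb (fun i => period_class_at o (g i)) c].
Proof.
have [K K0 KP] := lattice_cocompact o.
have [p pP] := choice (lattice_local_data o).
pose C := [set T : 'rV[R]_n | `|T| <= K + K + 2].
have Cc : compact C.
  apply: bounded_closed_compact.
    exists (K + K + 2); split=> [|M KM T /= TK]; first exact: num_real.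
    by rewrite (le_trans TK)// ltW.
  have -> : C = (fun T : 'rV[R]_n => `|T|) @^-1` [set x | x <= K + K + 2] by [].
  by apply: closed_comp => [T _|]; [exact: norm_continuous|exact: closed_le].
have := Cc; rewrite compact_cover.
move=> /(_ _ setT (fun T => ball T (p T).1)) [T _|T _|D _ CD].
- exact: ball_open.
- by exists T => //; apply: ballxx; have [] := pP T.
have {}CD T : `|T| <= K + K + 2 -> exists2 T0, T0 \in D & `|T - T0| < (p T0).1.
  by move=> /CD[T0 T0D]; rewrite -ball_normE /= distrC => ?; exists T0.
have : nbhs o (\bigcap_(T in [set` D]) (p T).2).
  by apply: filter_bigI => T _; have [] := pP T.
rewrite nbhsE => -[U oU UD].
have UDT T o' : T \in D -> U o' -> (p T).2 o' by move=> TD /UD; exact.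
have K0' := ltW K0.
exists U; split => //.
  move=> o' T Uo'; suff : T \in lattice o' -> exists s c, flat_section U s c /\ s o' = T.
    move=> + To' => /(_ To')[s [c [sc sT]]]; exists s => //.
    by have [_ cE _] := sc _ Uo'; rewrite -sT cE.
  apply: (@bounded_generation _ _ _ K
    (fun T => exists s c, flat_section U s c /\ s o' = T)) => //.
  (* A period at [o] near [T1] is moved to a period at [o'], at the cost of 1/2. *)
  - move=> T1 T1K; have [V Vo T1V] := KP T1.
    have VK : `|V| <= K + K + 2.
      have -> : V = T1 - (T1 - V) by rewrite subKr.
      by rewrite (le_trans (ler_normB _ _))// (le_trans (lerD T1K T1V))//; lra.
    have [T0 T0D VT0] := CD _ VK; have [_ _ _ /(_ o' V)] := pP T0.
    case=> [|//|//|W Wo' VW]; first exact: UDT.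
    exists W => //; have -> : T1 - W = (T1 - V) + (V - W) by rewrite addrA subrK.
    by rewrite (le_trans (ler_normD _ _))// lerD.
  - by exists (fun=> 0), 0; split => //; exact: flat_section0.
  - move=> T1 T2 _ _ [s1 [c1 [sc1 sT1]]] [s2 [c2 [sc2 sT2]]].
    by exists (fun o => s1 o + s2 o), (c1 + c2); split; [exact: flat_sectionD|rewrite sT1 sT2].
  - move=> T1 T1o' T1K; have [T0 T0D T10] := CD _ T1K; have [_ _ /(_ o' T1) + _] := pP T0.
    case=> [|//|//|_ [s sc sT1]]; first exact: UDT.
    by exists s, (period_class_at o T0); split => //; apply: flat_sectionS sc => ? ?; exact: UDT.
(* The centres that are periods at [o] carry the classes of all short periods at [o], hence generate
   the image. *)
pose E := [seq T <- enum_fset D | T \in lattice o].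
exists (size E), (fun i => tnth (in_tuple E) i); split=> [i|].
  by have := mem_tnth i (in_tuple E); rewrite mem_filter => /andP[].
apply: (@bounded_generation _ _ _ K (fun T => exists c,
    period_class_at o T = zcomb (fun i => period_class_at o (tnth (in_tuple E) i)) c)) => //.
- move=> T _; have [V Vo TV] := KP T; exists V => //.
  by rewrite (le_trans TV)// lerDl invr_ge0.
- by exists 0; rewrite raddf0 period_class_at0.
- move=> T V To Vo [c cT] [d dV]; exists (c + d).
  by rewrite raddfD /= -cT -dV period_class_atD.
- move=> T To TK; have [T0 T0D TT0] := CD _ TK; have [_ no /(_ o T) + _] := pP T0.
  case=> [|//|//|T0o [s sc sT]]; first exact: nbhs_singleton.
  have T0E : T0 \in in_tuple E by rewrite mem_filter T0o.
  have /tnthP[i iE] := T0E; exists (delta_mx 0 i); rewrite zcomb_delta -iE.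
  by have [_ + _] := sc o (nbhs_singleton no); rewrite sT.
Qed.

End Covering.

(** * Lifts of paths and the image of rho *)

Section Rho.
Context (R : realType) (k n : nat) (S : regular_integrable_system R k n).
Local Notation O := (orbit_space S).
Local Notation H := (H1_mod_torsion R S).

Lemma rhoE (v : lattice_bundle S) :
  rho S v = period_class_at (bundle_proj v) (bundle_vec v).
Proof. by apply: rho_period_class; rewrite /orbit_proj reprK. Qed.

(** By uniqueness, bundle points near [v] lie on the local section through [v], along which the
    class is constant. *)
Lemma rho_locally_constant (v : lattice_bundle S) :
  \forall w \near v, rho S w = rho S v.
Proof.
have [r [U [s [/andP[r0 _] oU sP sU _]]]] :=
  period_class_at_local_section (bundle_vec_lattice v) ltr01.
have nU : nbhs (\val v) ([set p | U p.1] `&` [set p | `|p.2 - bundle_vec v| < r]).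
  apply: filterI; first exact: (cvg_fst (open_nbhs_nbhs oU)).
  exact: (cvgrPdistC_lt _ _).1 cvg_snd _ r0.
have : nbhs v (set_val @^-1`
    ([set p : O * 'rV[R]_n | U p.1] `&` [set p | `|p.2 - bundle_vec v| < r])).
  exact: initial_continuous nU.
apply: filterS => w [/= Uw wr]; have [_ _ E] := sP _ Uw.
by rewrite !rhoE -E -(sU _ (bundle_vec w))//; exact: bundle_vec_lattice.
Qed.

Lemma zcomb_lattice (o : O) N (g : 'I_N -> 'rV[R]_n) c :
  (forall i, g i \in lattice o) -> zcomb g c \in lattice o.
Proof. by move=> go; apply: rpred_sum => i _; rewrite rpredMz. Qed.

Lemma period_class_at_zcomb (o : O) N (g : 'I_N -> 'rV[R]_n) c :
  (forall i, g i \in lattice o) ->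
  period_class_at o (zcomb g c) = zcomb (fun i => period_class_at o (g i)) c.
Proof.
move=> go; pose phi (T : lattice_group o) := period_class_at o (val T).
have phiB : GRing.zmod_morphism phi.
  by move=> T U; rewrite /phi raddfB period_class_atB//; exact: valP.
pose Phi : {additive lattice_group o -> H} := HB.pack phi (GRing.isZmodMorphism.Build _ _ phi phiB).
pose g' i : lattice_group o := exist _ (g i) (go i).
have -> : zcomb g c = val (zcomb g' c).
  by rewrite /zcomb raddf_sum; apply: eq_bigr => i _; rewrite raddfMz.
rewrite -[LHS]/(Phi (zcomb g' c)) /zcomb raddf_sum; apply: eq_bigr => i _.
by rewrite raddfMz.
Qed.

(** Flat sections start at any point of [U], not only at its centre, so a class passes between
    fibres in both directions and being attained is locally constant. *)
Lemma period_class_at_transfer (o o' : O) T : connected [set: S] -> T \in lattice o ->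
  exists2 T', T' \in lattice o' & period_class_at o' T' = period_class_at o T.
Proof.
move=> cS To; have [x xo] := orbit_proj_surj o; have [x' xo'] := orbit_proj_surj o'.
pose Q (y : S) := exists2 T', T' \in lattice (orbit_proj y) &
  period_class_at (orbit_proj y) T' = period_class_at o T.
rewrite -xo'; apply: (connected_locally_constant (Q := Q) cS _ (x := x));
  last by exists T; rewrite ?xo.
move=> y; have [U [oU sU _]] := lattice_covering (orbit_proj y).
have Uy : U (orbit_proj y) by case: oU.
have : nbhs y (@orbit_proj R k n S @^-1` U).
  by apply: orbit_proj_continuous; exact: open_nbhs_nbhs.
apply: filterS => z /= Uz; rewrite /Q; split=> -[T' T'o <-].
  have [s sc _] := sU _ _ Uz T'o; have [so sE _] := sc _ Uy.
  by exists (s (orbit_proj y)).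
have [s sc _] := sU _ _ Uy T'o; have [so sE _] := sc _ Uz.
by exists (s (orbit_proj z)).
Qed.

Lemma connected_R : connected [set: R].
Proof. by apply/connected_intervalP => x y _ _ z _. Qed.

Definition clamp01 (t : R) := Num.max 0 (Num.min 1 t).

Lemma clamp01_itv t : clamp01 t \in `[0, 1].
Proof. by rewrite in_itv /= le_max lexx /= ge_max ler01 ge_min lexx. Qed.

Lemma clampE (a b t : R) : a <= t -> t <= b -> Num.max a (Num.min b t) = t.
Proof. by move=> at_ tb; rewrite min_r// max_r. Qed.

Lemma within_clamp01_continuous (X : topologicalType) (f : R -> X) :
  {within `[0, 1], continuous f} -> continuous (f \o clamp01).
Proof.
move=> /subspace_continuousP cf t.
apply: cvg_comp (cf _ (clamp01_itv t)) => A /= wA.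
have : \forall s \near t, (clamp01 s \in `[0, 1] -> A (clamp01 s)).
  exact: (@clamp_continuous _ 0 1 t _ wA).
by apply: filterS => s; apply; exact: clamp01_itv.
Qed.

(** Continuity argument: the times up to which a lift exists form a locally constant condition on
    the connected line. *)
Lemma continuous_lift (gamma : R -> O) (T0 : 'rV[R]_n) :
  continuous gamma -> T0 \in lattice (gamma 0) ->
  exists tau : R -> 'rV[R]_n, [/\ continuous tau, tau 0 = T0 &
    forall s, 0 <= s <= 1 -> tau s \in lattice (gamma s)].
Proof.
move=> cg T0o.
pose Q (t : R) := exists tau : R -> 'rV[R]_n, [/\ continuous tau, tau 0 = T0 &
    forall s, 0 <= s <= t -> tau s \in lattice (gamma s)].
have Qle t t' : t' <= t -> Q t -> Q t'.
  move=> tt' [tau [ct t0 tP]]; exists tau; split => // s /andP[s0 st].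
  by apply: tP; rewrite s0 (le_trans st).
have Q0 : Q 0.
  exists (fun=> T0); split => //; first exact: cst_continuous.
  by move=> s s0; have -> : s = 0 by apply/le_anti; rewrite andbC.
apply: (connected_locally_constant (Q := Q) connected_R _ (x := 0)) => // u.
have [U [oU sU _]] := lattice_covering (gamma u).
have : nbhs u (gamma @^-1` U) by apply: cg; exact: open_nbhs_nbhs.
move=> /nbhs_ballP[d /= d0 dU].
have ext t t' : ball u d t -> ball u d t' -> Q t -> Q t'.
  (* For negative [t] the extension starts at time 0, where a lift is already given. *)
  move=> tB t'B Qt; pose a : R := Num.max 0 t.
  have a0 : 0 <= a by rewrite le_max lexx.
  have Qa : Q a by rewrite /a; case: (leP 0 t).
  have ta' : t <= a by rewrite le_max lexx orbT.
  clearbody a.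
  have [t'a|at'] := leP t' a; first exact: Qle Qa.
  have Uat' s : a <= s <= t' -> U (gamma s).
    move=> /andP[as_ st']; apply: dU; move: tB t'B; rewrite -!ball_normE /= !ltr_distl.
    have ts : t <= s by exact: le_trans as_.
    by move=> /andP[t1 t2] /andP[t3 t4]; apply/andP; split; lra.
  have [tau [ct t0 tP]] := Qa.
  have ta : tau a \in lattice (gamma a) by apply: tP; rewrite a0 lexx.
  have Ua : U (gamma a) by apply: Uat'; rewrite lexx ltW.
  have [s sc sa] := sU _ _ Ua ta.
  have clampP r : a <= Num.max a (Num.min t' r) <= t'.
    by rewrite le_max lexx /= ge_max (ltW at') ge_min lexx.
  (* The lift is stopped at time [a] and the increment of the local section along [gamma] from [a]
     to [t'] is added; clamping makes this a single continuous formula. *)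
  exists (fun r => tau (Num.max 0 (Num.min a r)) + (s (gamma (Num.max a (Num.min t' r))) - tau a)).
  split.
  - move=> r; apply: (@cvgD _ _ _ (nbhs r)).
      apply: (@continuous_comp _ _ _ (fun r => Num.max 0 (Num.min a r)) tau); last exact: ct.
      exact: clamp_continuous.
    apply: (@cvgB _ _ _ (nbhs r)); last exact: cvg_cst.
    apply: (@continuous_comp _ _ _ (fun r => Num.max a (Num.min t' r)) (fun z => s (gamma z))).
      exact: clamp_continuous.
    apply: (@continuous_comp _ _ _ gamma s); first exact: cg.
    by have [_ _] := sc _ (Uat' _ (clampP r)).
  - have t'0 : 0 <= t' by exact: le_trans (ltW at').
    rewrite (clampE (lexx 0) a0) (min_r t'0) (max_l a0).
    by rewrite sa subrr addr0.
  - move=> r /andP[r0 rt'].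
    have [ra|] := boolP (r <= a); last rewrite -ltNge => ar.
      rewrite (clampE r0 ra) (min_r rt') (max_l ra) sa subrr addr0.
      by apply: tP; rewrite r0.
    rewrite (min_l (ltW ar)) (max_r a0) clampE ?(ltW ar)// addrC subrK.
    by have [] := sc _ (Uat' r _); rewrite ?(ltW ar).
have := nbhsx_ballx u d d0.
by apply: filterS => t tB; split; apply: ext => //; exact: ballxx.
Qed.

(** [monodromy] chooses an endpoint among all lifts; the lift built here shows that the choice is
    not the default, and the conclusion gives a lift with the chosen endpoint. *)
Lemma monodromy_lift (gamma : R -> O) (v : lattice_bundle S) :
  is_path gamma -> bundle_proj v = gamma 0 ->
  exists2 Gamma, is_lift gamma Gamma & Gamma 0 = v /\ Gamma 1 = monodromy gamma v.
Proof.
move=> /within_clamp01_continuous cg vg.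
have c0 : clamp01 0 = 0 by rewrite /clamp01 clampE.
have T0o : bundle_vec v \in lattice ((gamma \o clamp01) 0).
  by rewrite /= c0 -vg bundle_vec_lattice.
have [tau [ct t0 tP]] := continuous_lift cg T0o.
have inL s : lattice_bundle S (gamma (clamp01 s), tau (clamp01 s)).
  have := clamp01_itv s; rewrite in_itv /= => s01.
  have cc : clamp01 (clamp01 s) = clamp01 s.
    by case/andP: s01 => c1 c2; rewrite {1}/clamp01 clampE.
  by have := tP _ s01; rewrite /lattice_bundle /= cc.
pose Gamma s : lattice_bundle S :=
  exist _ (gamma (clamp01 s), tau (clamp01 s)) (mem_set (inL s)).
suff [L G0] : is_lift gamma Gamma /\ Gamma 0 = v.
  have ex : [set w | exists Gamma, [/\ is_lift gamma Gamma, Gamma 0 = v & Gamma 1 = w]]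
      (Gamma 1) by exists Gamma.
  have [Gamma' [L' G'0 G'1]] :=
    xgetPex (fibre_incl (0 : lattice_group (gamma 1))) (ex_intro _ _ ex).
  by exists Gamma'.
split; last first.
  apply: val_inj; rewrite /= c0 t0 -vg.
  by case: (v) => -[].
split.
  apply: continuous_subspaceT; apply: continuous_comp_initial => s.
  apply: (@cvg_pair _ _ _ (nbhs s) (nbhs (gamma (clamp01 s))) (nbhs (tau (clamp01 s))) _ _ _
    (gamma \o clamp01) (tau \o clamp01)); first exact: cg.
  by apply: (@continuous_comp _ _ _ clamp01 tau); [exact: clamp_continuous|exact: ct].
by move=> s; rewrite in_itv /= => /andP[s0 s1]; rewrite /bundle_proj /= /clamp01 clampE.
Qed.

Lemma rho_lift (gamma : R -> O) (Gamma : R -> lattice_bundle S) :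
  is_lift gamma Gamma -> rho S (Gamma 1) = rho S (Gamma 0).
Proof.
move=> [/within_clamp01_continuous cG _].
have -> : Gamma 1 = (Gamma \o clamp01) 1 by rewrite /= /clamp01 clampE.
apply: (connected_locally_constant (Q := fun t => rho S ((Gamma \o clamp01) t) = rho S (Gamma 0))
  connected_R _ (x := 0)); last by rewrite /= /clamp01 clampE.
move=> t; have : \forall s \near t, rho S ((Gamma \o clamp01) s) = rho S ((Gamma \o clamp01) t).
  exact: (cG t _ (rho_locally_constant _)).
by apply: filterS => s ->.
Qed.

End Rho.

(** * The image of [rho] as a free group, and invariance under monodromy *)

Theorem corollary15 (R : realType) (k n : nat)
    (S : regular_integrable_system R k n)
    (M_nonempty : [set: S] !=set0) (M_connected : connected [set: S]) :
  (exists (l : nat) (emb : {additive 'rV[int]_l -> H1_mod_torsion R S})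
          (rhoZ : lattice_bundle S -> discrete_topology 'rV[int]_l),
    [/\ (l <= n)%N,
        injective emb /\ range emb = range (rho S),
        forall v, emb (rhoZ v) = rho S v,
        continuous rhoZ
      & forall o : orbit_space S,
          let rho_o : lattice_group o -> 'rV[int]_l :=
            fun T => rhoZ (fibre_incl T) in
          GRing.zmod_morphism rho_o /\ range rho_o = setT]) /\
  (forall gamma : R -> orbit_space S, is_path gamma ->
     forall v : lattice_bundle S, bundle_proj v = gamma 0 ->
       rho S (monodromy gamma v) = rho S v).
Proof.
split; last first.
  move=> gamma pg v vg; have [Gamma L [<- <-]] := monodromy_lift pg vg.
  exact: rho_lift L.
have [x0 _] := M_nonempty; pose o0 := @orbit_proj R k n S x0.
(* One fibre suffices for a finite set of generators of the image, since all fibres have the same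
   image. *)
have [_ [_ _ [N [g [go gP]]]]] := lattice_covering o0.
have [l [e [eg ge einj]]] := zcomb_basis (@mod_torsion_torsionfree R S)
  (fun i => period_class_at o0 (g i)).
have eT i : exists T, T \in lattice o0 /\ period_class_at o0 T = e i.
  have [c ->] := eg i; exists (zcomb g c).
  by split; [exact: zcomb_lattice|exact: period_class_at_zcomb].
have [T /all_and2[To Te]] := choice eT.
have eE c : zcomb e c = period_class_at o0 (zcomb T c).
  by rewrite period_class_at_zcomb//; congr zcomb; apply/funext.
have emb_period o c : exists2 U, U \in lattice o & period_class_at o U = zcomb e c.
  rewrite eE; apply: period_class_at_transfer => //; exact: zcomb_lattice.
have exZ (v : lattice_bundle S) : exists d, zcomb e d = rho S v.
  have [U Uo UE] := period_class_at_transfer o0 M_connected (bundle_vec_lattice v).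
  have [c cU] := gP _ Uo; have [d dE] := ge c.
  by exists d; rewrite -dE -cU UE -rhoE.
have [rhoZ rhoZE] := choice exZ.
have rhoZ_fibre o (U : lattice_group o) : zcomb e (rhoZ (fibre_incl U)) = period_class_at o (val U).
  by rewrite rhoZE rhoE.
exists l, (zcomb e), rhoZ; split => //.
(* A relation among the periods [T i] would give one among their classes [e i]; so the [T i] are
   independent in a discrete subgroup. *)
- have [d d0 dP] := lattice_uniformly_discrete o0.
  apply: (discrete_rank (L := lattice o0) (T := T) d0 (nbhs_singleton dP)) => //.
  by move=> c c' cc'; apply: einj; rewrite !eE cc'.
- split => //; apply/seteqP; split=> [_ [c _ <-]|_ [v _ <-]]; last first.
    by exists (rhoZ v) => //; exact: rhoZE.
  have [U Uo UE] := emb_period o0 c.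
  by exists (fibre_incl (exist _ U Uo : lattice_group o0)) => //; rewrite rhoE.
(* The target is discrete, and injectivity of the embedding turns local constancy of [rho] into that
   of [rhoZ]. *)
- move=> v A /nbhs_singleton Av; apply: filterS (rho_locally_constant v) => w wv.
  suff E : rhoZ w = rhoZ v by rewrite /= E.
  by apply: einj; rewrite !rhoZE.
- move=> o; split=> [U V|].
    by apply: einj; rewrite raddfB /= !rhoZ_fibre raddfB period_class_atB//; exact: valP.
  apply/seteqP; split=> // c _; have [U Uo UE] := emb_period o c.
  by exists (exist _ U Uo) => //; apply: einj; rewrite rhoZ_fibre.
Qed.
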